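(* Let $(a,b)\in\mathbb{R}^2$ with $a<b$. If $f\in AC([a,b];\mathbb{R})$ is such that $f(a)=0$, then $$\lim_{\alpha\to 0^+}\left\|\mathcal{D}_a^\alpha f-\frac{df}{dx}\right\|_{L^1([a,b];\mathbb{R})}=0.$$ If $f\in AC([a,b];\mathbb{R})$ is such that $f(b)=0$, then $$\lim_{\alpha\to 0^+}\left\|\mathcal{D}_b^\alpha f-\frac{df}{dx}\right\|_{L^1([a,b];\mathbb{R})}=0.$$
   Context: $AC([a,b];\mathbb{R})$ is the space of real-valued absolutely continuous functions on $[a,b]$. Let $E_1(x)=\int_x^\infty \frac{e^{-t}}{t}\,dt$ for $x>0$. For $\alpha>0$ and $f\in L^1([a,b];\mathbb{R})$, define for a.e. $x\in[a,b]$ $$(J_a^\alpha f)(x)=\frac{1}{\alpha}\int_a^x E_1\left(\frac{x-t}{\alpha}\right)f(t)\,dt,\qquad (J_b^\alpha f)(x)=\frac{1}{\alpha}\int_x^b E_1\left(\frac{t-x}{\alpha}\right)f(t)\,dt.$$ A function in $L^1([a,b];\mathbb{R})$ has an absolutely continuous representative if it coincides a.e. on $[a,b]$ with a function in $AC([a,b];\mathbb{R})$; it is then identified with that function. If $J_a^\alpha f$ (respectively $J_b^\alpha f$) has an absolutely continuous representative, the left-sided (respectively right-sided) fractional derivative of order $\alpha$ of $f$ is $(\mathcal{D}_a^\alpha f)(x)=\frac{d}{dx}(J_a^\alpha f)(x)$ (respectively $(\mathcal{D}_b^\alpha f)(x)=\frac{d}{dx}(J_b^\alpha f)(x)$) for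 a.e. $x\in[a,b]$. *)

(* Defs.v *)
From HB Require Import structures.
From mathcomp Require Import all_boot all_order all_algebra.
From mathcomp Require Import all_classical all_reals all_analysis.

Set Implicit Arguments.
Unset Strict Implicit.
Unset Printing Implicit Defensive.

Import Order.TTheory GRing.Theory Num.Theory.
Import numFieldNormedType.Exports.

Local Open Scope classical_set_scope.
Local Open Scope ring_scope.

(* A function on [a, b] is represented by a total function R -> R whose values
   outside [a, b] are irrelevant. *)

Definition abs_continuous {R : realType} (a b : R) (f : R -> R) : Prop :=
  forall e : R, 0 < e -> exists2 d : R, 0 < d &
    forall (n : nat) (u v : 'I_n -> R),
      (forall i, a <= u i /\ u i < v i /\ v i <= b) ->
      trivIset [set: 'I_n] (fun i => `]u i, v i[%classic) ->
      \sum_(i < n) (v i - u i) < d ->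
      \sum_(i < n) `|f (v i) - f (u i)| < e.

(* Only meaningful for 0 < x: the integral diverges at x = 0, where Rintegral
   returns the junk value 0.  Below, x = 0 occurs only at one integration
   point. *)
Definition expint1 {R : realType} (x : R) : R :=
  \int[lebesgue_measure]_(t in `[x, +oo[) (expR (- t) / t).

Definition left_J {R : realType} (a alpha : R) (f : R -> R) (x : R) : R :=
  alpha^-1 *
    \int[lebesgue_measure]_(t in `[a, x]) (expint1 ((x - t) / alpha) * f t).

Definition right_J {R : realType} (b alpha : R) (f : R -> R) (x : R) : R :=
  alpha^-1 *
    \int[lebesgue_measure]_(t in `[x, b]) (expint1 ((t - x) / alpha) * f t).

Definition is_AC_rep {R : realType} (a b : R) (g F : R -> R) : Prop :=
  abs_continuous a b F /\ ae_eq lebesgue_measure `[a, b]%classic g F.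

Definition has_AC_rep {R : realType} (a b : R) (g : R -> R) : Prop :=
  exists F : R -> R, is_AC_rep a b g F.

(* The values on [a, b] do not depend on the choice when a < b, since two
   continuous functions that agree a.e. on [a, b] agree on [a, b].  Without an
   absolutely continuous representative, this is g itself. *)
Definition AC_rep {R : realType} (a b : R) (g : R -> R) : R -> R :=
  xget g [set F | is_AC_rep a b g F].

(* As derivatives of absolutely continuous functions, these are meaningful at
   almost every point of [a, b]; derive1 is total, and it is a two-sided
   derivative, so that its values at a and b, a null set, are irrelevant. *)
Definition left_frac_derive {R : realType} (a b alpha : R) (f : R -> R) :
    R -> R :=
  derive1 (AC_rep a b (left_J a alpha f)).

Definition right_frac_derive {R : realType} (a b alpha : R) (f : R -> R) :
    R -> R :=
  derive1 (AC_rep a b (right_J b alpha f)).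

Definition L1norm {R : realType} (a b : R) (g : R -> R) : \bar R :=
  ('N[lebesgue_measure]_1%E[EFin \o (g \_ `[a, b])])%E.

(* Main.v *)
Require Import Defs.
From HB Require Import structures.
From mathcomp Require Import all_boot all_order all_algebra.
From mathcomp Require Import all_classical all_reals all_analysis.
From mathcomp Require Import measurable_realfun.
From mathcomp Require Import ring lra.

(* Put k(u) = alpha^-1 E_1(u / alpha) for u > 0 and k(u) = 0 for u <= 0, so that
   J_a^alpha f = k * f. An absolutely continuous f with f(a) = 0 is the
   difference of the primitives of two nonnegative integrable densities, by
   Jordan decomposition and Radon-Nikodym applied to the Lebesgue-Stieltjes
   measures of the two parts. If f is the primitive of rho, Tonelli shows that
   J_a^alpha f is the primitive of k * rho; hence D_a^alpha f = k * rho a.e.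

   Writing E_1 as an integral and exchanging integrals exhibits k * rho as an
   exponential mixture of left difference quotients,
     (k * rho)(y) = int_0^oo e^-t (f(y) - f(y - alpha t)) / (alpha t) dt,
   so by Fatou liminf_(alpha -> 0) (k * rho)(y) >= f'(y) = rho(y) for a.e. y.
   For rho >= 0, k * rho and rho have the same integral, and Scheffe's argument
   upgrades this bound to convergence in L^1. The right-sided case follows by
   the reflection x |-> -x. *)

Set Implicit Arguments.
Unset Strict Implicit.
Unset Printing Implicit Defensive.

Import Order.TTheory GRing.Theory Num.Theory.
Import numFieldNormedType.Exports.

Local Open Scope classical_set_scope.
Local Open Scope ring_scope.

(** * Absolute continuity and total variation *)

Section abs_continuity.
Context {R : realType}.
Implicit Types (a b : R) (f g : R -> R).

(** Enumerating [T] reduces to families indexed by ordinals. Arbitrary finite index types are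
    convenient later, when every interval of a family is itself cut into pieces indexed by a sigma
    type. *)
Lemma abs_continuous_finType a b f : abs_continuous a b f ->
  forall e : R, 0 < e -> exists2 d : R, 0 < d &
    forall (T : finType) (u v : T -> R),
      (forall i, a <= u i /\ u i < v i /\ v i <= b) ->
      trivIset [set: T] (fun i => `]u i, v i[%classic) ->
      \sum_i (v i - u i) < d ->
      \sum_i `|f (v i) - f (u i)| < e.
Proof.
move=> ac e e0; have [d d0 H] := ac e e0; exists d => // T u v uv tr ud.
have E (F : T -> R) : \sum_i F i = \sum_(i < #|T|) F (enum_val i).
  by rewrite (reindex (@enum_val T T))//; apply: onW_bij; exact: enum_val_bij.
rewrite E; rewrite E in ud.
apply: (H _ (u \o enum_val) (v \o enum_val)) => //=.
by move=> i j _ _ /(tr _ _ I I) /enum_val_inj.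
Qed.

Lemma abs_continuousB a b f g : abs_continuous a b f -> abs_continuous a b g ->
  abs_continuous a b (fun x => f x - g x).
Proof.
move=> acf acg e e0; have e20 : 0 < e / 2 by rewrite divr_gt0.
have [d1 d10 H1] := acf _ e20; have [d2 d20 H2] := acg _ e20.
exists (Num.min d1 d2); first by rewrite lt_min d10.
move=> n u v uv tr; rewrite lt_min => /andP[s1 s2].
rewrite (splitr e); apply: le_lt_trans (ltrD (H1 _ _ _ uv tr s1) (H2 _ _ _ uv tr s2)).
rewrite -big_split/=; apply: ler_sum => i _.
rewrite (_ : _ - _ = (f (v i) - f (u i)) - (g (v i) - g (u i))); last by ring.
exact: ler_normB.
Qed.

Section partition.
Variables (x y : R) (s : seq R).
Hypothesis xys : itv_partition x y s.
(** The list [s] of a partition omits its left endpoint, so [x] is put back in front: [P 0] is [x]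
    and [P (size s)] is [y]. *)
Let P i := nth y (x :: s) i.

Lemma partition_lt i j : (i < j <= size s)%N -> P i < P j.
Proof.
case: xys => + _ => /= xs /andP[ij js].
rewrite /P (lt_sorted_ltn_nth y (s := x :: s)) ?inE ?ltnS//.
exact: leq_trans (ltnW ij) js.
Qed.

Lemma partition_le i j : (i <= j <= size s)%N -> P i <= P j.
Proof.
move=> /andP[]; rewrite leq_eqVlt => /predU1P[->//|ij js].
by apply/ltW/partition_lt/andP.
Qed.

Lemma partition_last : P (size s) = y.
Proof. by rewrite /P; exact: itv_partition_nth_size xys. Qed.

Lemma partition_steps (i : 'I_(size s)) :
  [/\ x <= P i, P i < P i.+1 & P i.+1 <= y].
Proof.
split.
- by rewrite -[x]/(P 0); apply: partition_le; rewrite /= ltnW.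
- by apply: partition_lt; rewrite leqnn /=.
- by rewrite -[leRHS]partition_last; apply: partition_le; rewrite leqnn ltn_ord.
Qed.

Lemma partition_disjoint (i j : 'I_(size s)) :
  `]P i, P i.+1[ `&` `]P j, P j.+1[ !=set0 -> i = j.
Proof.
wlog : i j / (i <= j)%N.
  move=> h; have [ij|/ltnW ji] := leqP i j; first exact: h.
  by rewrite setIC => /(h _ _ ji) ->.
rewrite leq_eqVlt => /predU1P[ij _|ij [z [/=]]]; first exact/val_inj.
rewrite !in_itv/= => /andP[_ zi] /andP[zj _].
have : P i.+1 <= P j by apply: partition_le; rewrite ij /= ltnW.
by move=> /(lt_le_trans zi) /lt_trans /(_ zj); rewrite ltxx.
Qed.

Lemma sum_partition : \sum_(i < size s) (P i.+1 - P i) = y - x.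
Proof.
by rewrite -(big_mkord xpredT (fun i => P i.+1 - P i)) telescope_sumr// partition_last.
Qed.

Lemma variation_sum f :
  variation x y f s = \sum_(i < size s) `|f (P i.+1) - f (P i)|.
Proof. by rewrite /variation big_mkord. Qed.

End partition.

(** For [e = 1], the variation over any subinterval shorter than [d] is at most 1. Additivity of the
    variation and finitely many steps then bound it on all of [[a, b]]. *)
Lemma abs_continuous_BV a b f : a < b ->
  abs_continuous a b f -> bounded_variation a b f.
Proof.
move=> ab ac; have [d d0 H] := abs_continuous_finType ac ltr01.
have small x y : a <= x -> x <= y -> y <= b -> y - x < d ->
    (total_variation x y f <= 1)%E.
  move=> ax xy yb yxd; apply: ge_ereal_sup => _ [_ [s xys <-] <-].
  rewrite lee_fin variation_sum; apply/ltW/H => [i||].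
  - have [h1 h2 h3] := partition_steps xys i.
    by split; [exact: le_trans h1|split => //; exact: le_trans yb].
  - by move=> i j _ _; exact: partition_disjoint.
  - by rewrite sum_partition.
(* Steps have length [d / 2] because [small] asks for a length strictly below [d]. *)
have d20 : 0 < d / 2 by rewrite divr_gt0.
have d2d : d / 2 < d by rewrite ltr_pdivrMr// ltr_pMr// ltr1n.
have claim n x : a <= x -> x <= b -> x - a <= n%:R * (d / 2) ->
    (total_variation a x f <= n%:R%:E)%E.
  elim: n x => [|n IH] x ax xb.
    rewrite mul0r subr_le0 => xa; have -> : x = a by apply/le_anti/andP.
    by rewrite total_variationxx.
  (* One step back from [x], stopped at [a]: the induction hypothesis covers [[a, y]] and [small]
     covers [[y, x]]. *)
  move=> xan; pose y := Num.max a (x - d / 2).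
  have yx : y <= x by rewrite ge_max ax gerBl ltW.
  have ay : a <= y by rewrite le_max lexx.
  rewrite (total_variationD f ay yx) -natr1 EFinD; apply: leeD.
    apply: IH => //; first exact: le_trans yx xb.
    rewrite lerBlDr ge_max; apply/andP; split.
      by rewrite lerDr mulr_ge0// ltW.
    by move: xan; rewrite -natr1 mulrDl mul1r; lra.
  apply: small => //; apply: le_lt_trans d2d.
  by rewrite lerBlDr -lerBlDl le_max lexx orbT.
apply/(bounded_variationP _ (ltW ab)); rewrite ge0_fin_numE;
  last exact: total_variation_ge0 (ltW ab).
pose N := Num.bound ((b - a) / (d / 2)).
apply: le_lt_trans (ltry N%:R); apply: claim => //; first exact: ltW.
rewrite -ler_pdivrMr//; apply/ltW; apply: archi_boundP.
by rewrite divr_ge0// ?ltW// subr_gt0.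
Qed.

Lemma total_variation_fin a b f x : bounded_variation a b f -> a <= x -> x <= b ->
  total_variation a x f \is a fin_num.
Proof.
move=> bv ax xb; apply/(bounded_variationP _ ax).
exact: (bounded_variationl ax xb bv).
Qed.

Lemma fine_total_variationB a b f x y : bounded_variation a b f ->
  a <= x -> x <= y -> y <= b ->
  fine (total_variation a y f) - fine (total_variation a x f) =
  fine (total_variation x y f).
Proof.
move=> bv ax xy yb.
have fx := total_variation_fin bv ax (le_trans xy yb).
have fxy : total_variation x y f \is a fin_num.
  apply/(bounded_variationP _ xy).
  apply: (bounded_variationr ax xy).
  exact: (bounded_variationl (le_trans ax xy) yb bv).
by rewrite (total_variationD f ax xy) fineD// addrC addKr.
Qed.

(* Each given interval is refined by a partition that almost realizes the
   variation of f on it; all the pieces together form one family to which the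
   absolute continuity of f applies. *)
Lemma abs_continuous_total_variation a b f : a < b -> abs_continuous a b f ->
  abs_continuous a b (fun x => fine (total_variation a x f)).
Proof.
move=> ab ac e e0; have bv := abs_continuous_BV ab ac.
have e20 : 0 < e / 2 by rewrite divr_gt0.
have [d d0 H] := abs_continuous_finType ac e20; exists d => // n u v uv tr uvd.
(* The [n] errors [eta] add up to at most [e / 2]; dividing by [n.+1] keeps the denominator nonzero
   for the empty family. *)
pose eta := e / 2 / n.+1%:R.
have eta0 : 0 < eta by rewrite divr_gt0.
have : forall i, exists s, itv_partition (u i) (v i) s /\
    fine (total_variation (u i) (v i) f) < variation (u i) (v i) f s + eta.
  move=> i; have [aui [uvi vib]] := uv i.
  have fin : total_variation (u i) (v i) f \is a fin_num.
    apply/(bounded_variationP _ (ltW uvi)).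
    apply: (bounded_variationr aui (ltW uvi)).
    by apply: (bounded_variationl (le_trans aui (ltW uvi)) vib bv).
  have : (total_variation (u i) (v i) f - eta%:E < total_variation (u i) (v i) f)%E.
    by rewrite lteBlDr// lteDl// lte_fin.
  case/ereal_sup_gt => _ [_ [s uvs <-] <-] lts; exists s; split => //.
  by move: lts; rewrite -(fineK fin) -EFinB lte_fin ltrBlDr.
case/choice => s Hs.
pose T := {i : 'I_n & 'I_(size (s i))}.
pose U (t : T) := nth (v (tag t)) (u (tag t) :: s (tag t)) (tagged t).
pose W (t : T) := nth (v (tag t)) (u (tag t) :: s (tag t)) (tagged t).+1.
have steps (t : T) : [/\ u (tag t) <= U t, U t < W t & W t <= v (tag t)].
  exact: partition_steps (Hs (tag t)).1 (tagged t).
have sumT (F : forall i, 'I_(size (s i)) -> R) :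
    \sum_(t : T) F (tag t) (tagged t) = \sum_(i < n) \sum_(j < size (s i)) F i j.
  by rewrite (sig_big_dep (fun _ => true) (fun _ _ => true) F).
have : \sum_(t : T) `|f (W t) - f (U t)| < e / 2.
  apply: H => [t||].
  - have [aui [uvi vib]] := uv (tag t); have [h1 h2 h3] := steps t.
    by split; [exact: le_trans h1|split => //; exact: le_trans vib].
  - move=> t t' _ _ [z [zt zt']].
    have tt' : tag t = tag t'.
      apply: (tr _ _ I I); exists z; split.
        have [h1 _ h2] := steps t; move: zt; rewrite /= !in_itv/=.
        by move=> /andP[/(le_lt_trans h1) -> /lt_le_trans ->].
      have [h1 _ h2] := steps t'; move: zt'; rewrite /= !in_itv/=.
      by move=> /andP[/(le_lt_trans h1) -> /lt_le_trans ->].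
    case: t t' tt' zt zt' {steps} => i j [i' j'] /= ii'; subst i' => zt zt'.
    by congr Tagged; apply: (partition_disjoint (Hs i).1); exists z.
  - rewrite (sumT (fun i j => nth (v i) (u i :: s i) j.+1 - nth (v i) (u i :: s i) j)).
    rewrite (eq_bigr (fun i => v i - u i))// => i _.
    exact: sum_partition (Hs i).1.
rewrite (sumT (fun i j =>
  `|f (nth (v i) (u i :: s i) j.+1) - f (nth (v i) (u i :: s i) j)|)).
move=> vare.
apply: (@le_lt_trans _ _ (\sum_(i < n) (variation (u i) (v i) f (s i) + eta))).
  apply: ler_sum => i _; have [aui [uvi vib]] := uv i.
  rewrite (fine_total_variationB bv aui (ltW uvi) vib) ger0_norm.
    exact/ltW/(Hs i).2.
  by apply/fine_ge0/total_variation_ge0/ltW.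
rewrite big_split/= sumr_const card_ord (splitr e); apply: ltr_leD.
  by under eq_bigr do rewrite variation_sum.
rewrite -(mulr_natl eta) /eta mulrCA ger_pMr//.
by rewrite ler_pdivrMr// mul1r ler_nat.
Qed.

End abs_continuity.

(** * Density of a monotone absolutely continuous function *)

Section stieltjes_density.
Context {R : realType}.
Notation mu := (@lebesgue_measure R).
Implicit Types (a b : R) (f g : R -> R).

(** The endpoints are the infimum and the supremum of the intersection. The infimum is never
    attained, as [I] is open and [a] is excluded, while the supremum can be attained at [b]; hence
    the half-open shape, on which a Stieltjes measure is an increment. *)
Lemma open_interval_cap_itvoc (I : set R) a b : open I -> is_interval I ->
  I `&` `]a, b] !=set0 ->
  exists p q, [/\ a <= p, p < q, q <= b, `]p, q[ `<=` I & I `&` `]a, b] `<=` `]p, q]].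
Proof.
move=> oI iI E0; set E := I `&` _ in E0 *.
have left x : E x -> exists2 y, E y & y < x.
  move=> [Ix]; rewrite /= in_itv/= => /andP[ax xb].
  near x^'- => y; have yx : y < x by near: y; exact: nbhs_left_lt.
  exists y => //; split; last first.
    rewrite /= in_itv/= (le_trans (ltW yx) xb) andbT.
    by near: y; exact: nbhs_left_gt.
  by near: y; apply: cvg_within; exact: open_nbhs_nbhs.
have lbE : lbound E a by move=> x [_]; rewrite /= in_itv/= => /andP[/ltW].
have ubE : ubound E b by move=> x [_]; rewrite /= in_itv/= => /andP[].
have hi : has_inf E by split => //; exists a.
have hs : has_sup E by split => //; exists b.
have infE x : E x -> inf E < x.
  move=> /left[y Ey]; apply: le_lt_trans; exact: (ge_inf hi.2).
have supE x : E x -> x <= sup E by move=> Ex; exact: (ub_le_sup hs.2).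
exists (inf E), (sup E); split.
- exact: lb_le_inf.
- by have [x Ex] := E0; exact: lt_le_trans (infE _ Ex) (supE _ Ex).
- exact: ge_sup.
- move=> z; rewrite /= in_itv/= => /andP[pz zq].
  have [w [Iw _] wz] := inf_lt E0 pz.
  have [w' [Iw' _] zw'] := sup_gt E0 zq.
  by apply: (iI w w') => //; rewrite !ltW.
- by move=> x Ex; rewrite /= in_itv/= infE// supE.
Unshelve. all: by end_near. Qed.

Lemma lebesgue_stieltjes_itvoc (F : cumulative R R) (p q : R) : p <= q ->
  lebesgue_stieltjes_measure F `]p, q] = (F q - F p)%:E.
Proof.
move=> pq; rewrite /lebesgue_stieltjes_measure/= /measure_extension/=.
rewrite measurable_mu_extE//; last exact: is_ocitv.
rewrite [LHS]/= wlength_itv/= lte_fin; case: ltP => [_|qp]; first by rewrite EFinB.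
by have -> : p = q; [apply/le_anti/andP | rewrite subrr].
Qed.

(** Uniform continuity, from families made of a single interval. *)
Lemma abs_continuous_dist a b g : abs_continuous a b g -> forall e, 0 < e ->
  exists2 d, 0 < d & forall x y, a <= x -> x <= y -> y <= b -> y - x < d ->
    `|g y - g x| < e.
Proof.
move=> ac e e0; have [d d0 H] := ac e e0; exists d => // x y ax + yb yxd.
rewrite le_eqVlt => /predU1P[->|xy]; first by rewrite subrr normr0.
have := H 1%N (fun=> x) (fun=> y); rewrite !big_ord1; apply => //.
by move=> i j _ _ _; rewrite !ord1.
Qed.

(** Outer regularity encloses [N] in an open [U] of measure below [d]. The components of [U], cut
    down to []a, b]], lie in half-open intervals whose Stieltjes masses are increments of [g], and
    absolute continuity bounds their sum by [e]. This is the domination that Radon-Nikodym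
    requires. *)
Lemma abs_continuous_null a b g (F : cumulative R R) :
  abs_continuous a b g -> (forall x, a <= x <= b -> F x = g x) ->
  forall N, measurable N -> mu N = 0%E ->
    lebesgue_stieltjes_measure F (N `&` `]a, b]) = 0%E.
Proof.
move=> ac Fg N mN N0.
pose nu : {measure set (measurableTypeR R) -> \bar R} :=
  lebesgue_stieltjes_measure F.
rewrite -[LHS]/(nu (N `&` `]a, b])).
apply/eqP; rewrite eq_le measure_ge0 andbT; apply/lee_addgt0Pr => e e0.
rewrite add0e.
have [d d0 H] := abs_continuous_finType ac e0.
have Noo : (mu N < +oo)%E by rewrite N0.
have [U [oU NU UNd]] := lebesgue_regularity_outer mN Noo d0.
have Ud : (mu U < d%:E)%E.
  have -> : U = (U `\` N) `|` N by rewrite setUC setDUK.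
  have mU : measurable U by exact: open_measurable.
  apply: le_lt_trans UNd; apply: le_trans (measureU2 _ _ _) _ => //.
    exact: measurableD.
  by rewrite [X in (_ + X <= _)%E]N0 adde0.
pose I := open_disjoint_itv oU; pose E k := I k `&` `]a, b].
have mI k : measurable (I k) by apply: open_measurable; exact: open_disjoint_itv_open.
have mE k : measurable (E k) by exact: measurableI.
have trI : trivIset setT I by exact: open_disjoint_itv_trivIset.
(* The pair [(0, 0)] is a placeholder for the components that miss []a, b]]. *)
have pq : forall k, exists z : R * R, E k !=set0 ->
    [/\ a <= z.1, z.1 < z.2, z.2 <= b, `]z.1, z.2[ `<=` I k & E k `<=` `]z.1, z.2]].
  move=> k; have [Ek|nEk] := pselect (E k !=set0); last by exists (0, 0).
  have [//|//|p [q H1]] := @open_interval_cap_itvoc (I k) a b _ _ Ek.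
  - exact: open_disjoint_itv_open.
  - exact: open_disjoint_itv_is_interval.
  - by exists (p, q).
case/choice: pq => z Hz.
have trE : trivIset setT E.
  by move=> i j _ _ [x [[Iix _] [Ijx _]]]; apply: (trI _ _ Logic.I Logic.I); exists x.
apply: (@le_trans _ _ (nu (\bigcup_k E k))).
  apply: le_measure; rewrite ?inE; first exact: measurableI.
    by apply: bigcup_measurable => k _; exact: mE.
  move=> x [/NU]; rewrite (open_disjoint_itv_bigcup oU) => -[k _ Ikx] abx.
  by exists k.
rewrite measure_semi_bigcup//; last exact: bigcupT_measurable.
(* Absolute continuity speaks of finite families, so every partial sum of the series is bounded by
   [e]. *)
apply: lime_le; first exact: is_cvg_nneseries.
apply: nearW => n; rewrite big_mkord.
(* Empty pieces are discarded: their placeholder endpoints violate the strict inequality between the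
   ends of an interval. *)
pose s := [seq k <- iota 0 n | `[< E k !=set0 >]].
have sP (F0 : nat -> \bar R) : (forall k, ~ (E k !=set0) -> F0 k = 0%E) ->
    (\sum_(k < n) F0 k = \sum_(i < size s) F0 (nth 0%N s i))%E.
  move=> F00; rewrite -(big_mkord xpredT F0) /index_iota subn0.
  rewrite (bigID (fun k => `[< E k !=set0 >]))/= [X in (_ + X)%E]big1 ?adde0.
    by rewrite -big_filter (big_nth 0%N) big_mkord.
  by move=> k /asboolP; exact: F00.
have Es (i : 'I_(size s)) : E (nth 0%N s i) !=set0.
  by have := mem_nth 0%N (ltn_ord i); rewrite mem_filter => /andP[/asboolP].
rewrite [leLHS](sP (fun k => nu (E k))); last first.
  move=> k nEk; have -> : E k = set0; last exact: measure0.
  by apply/seteqP; split => // x Ex; apply: nEk; exists x.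
pose u (i : 'I_(size s)) := (z (nth 0%N s i)).1.
pose v (i : 'I_(size s)) := (z (nth 0%N s i)).2.
have Huv i : [/\ a <= u i, u i < v i, v i <= b,
    `]u i, v i[ `<=` I (nth 0%N s i) & E (nth 0%N s i) `<=` `]u i, v i]].
  exact: Hz.
have trs : trivIset [set: 'I_(size s)] (fun i => I (nth 0%N s i)).
  move=> i j _ _ /(trI _ _ Logic.I Logic.I) /eqP; rewrite nth_uniq//.
    by move=> /eqP/val_inj.
  by rewrite filter_uniq// iota_uniq.
have truv : trivIset [set: 'I_(size s)] (fun i => `]u i, v i[%classic).
  move=> i j _ _ [x [xi xj]]; apply: (trs _ _ Logic.I Logic.I); exists x; split.
    by have [_ _ _ h _] := Huv i; exact: h.
  by have [_ _ _ h _] := Huv j; exact: h.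
apply: (@le_trans _ _ (\sum_(i < size s) (g (v i) - g (u i))%:E)%E).
  apply: lee_sum => i _; have [h1 h2 h3 h4 h5] := Huv i.
  rewrite -!Fg ?h1 ?h3 ?(le_trans h1 (ltW h2)) ?(le_trans (ltW h2) h3)//.
  rewrite -lebesgue_stieltjes_itvoc; last exact: ltW.
  by apply: le_measure; rewrite ?inE; [exact: mE|exact: measurable_itv|].
rewrite sumEFin lee_fin; apply: le_trans (ler_norm _) _.
apply: le_trans (ler_norm_sum _ _ _) _; apply/ltW/H => //.
  by move=> i; have [] := Huv i.
rewrite -lte_fin -sumEFin; apply: le_lt_trans Ud.
apply: (@le_trans _ _ (\sum_(i < size s) mu (`]u i, v i[))%E).
  apply: lee_sum => i _; rewrite lebesgue_measure_itv/= lte_fin.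
  by have [_ -> _ _ _] := Huv i; rewrite EFinB.
rewrite -measure_semi_additive_ord//; last exact: bigsetU_measurable.
apply: le_measure; rewrite ?inE//.
- by apply: bigsetU_measurable.
- exact: open_measurable.
- rewrite (open_disjoint_itv_bigcup oU).
  elim/big_ind: _ => // [A B|i _]; first by rewrite subUset.
  by have [_ _ _ h _] := Huv i; move=> x /h Ix; exists (nth 0%N s i).
Qed.

(** Extended by constants, [g] is a cumulative function. Its Stieltjes measure restricted to []a,
    b]] is finite and dominated by Lebesgue measure, and [rho] is the Radon-Nikodym derivative. *)
Lemma abs_continuous_density a b g : a < b -> abs_continuous a b g ->
  {in `[a, b] &, nondecreasing_fun g} ->
  exists rho : R -> R, [/\ measurable_fun setT rho, forall x, 0 <= rho x,
    (\int[mu]_x (rho x)%:E < +oo)%E,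
    forall x, ~ `]a, b]%classic x -> rho x = 0 &
    forall x, a <= x -> x <= b ->
      (\int[mu]_(t in `]-oo, x]) (rho t)%:E = (g x - g a)%:E)%E].
Proof.
move=> ab ac ndg.
(* Projection onto [[a, b]]; being monotone and 1-Lipschitz, it passes monotonicity and continuity
   of [g] on to [G]. *)
pose c x := Num.max a (Num.min x b).
have cab x : c x \in `[a, b].
  by rewrite in_itv/= /c le_max lexx/= ge_max (ltW ab) ge_min lexx orbT.
have cE x : a <= x <= b -> c x = x.
  by move=> /andP[ax xb]; rewrite /c (min_idPl xb) (max_idPr ax).
have cnd x y : x <= y -> c x <= c y.
  move=> xy; rewrite /c ge_max !le_max lexx/=.
  by apply/orP; right; rewrite le_min !ge_min xy lexx orbT.
have cB x y : x <= y -> c y - c x <= y - x.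
  move=> xy; rewrite /c.
  by case: (leP x b) => xb; case: (leP y b) => yb; case: (leP a x) => h1;
    case: (leP a y) => h2; case: (leP a b) => h3; lra.
pose G := g \o c.
have Gnd : {homo G : x y / x <= y}.
  by move=> x y xy; apply: ndg => //; exact: cnd.
have Grc : right_continuous G.
  move=> x; apply/cvgrPdist_lt => e e0.
  have [d d0 H] := abs_continuous_dist ac e0.
  near=> y; rewrite distrC; apply: H.
  - by have := cab x; rewrite in_itv/= => /andP[].
  - by apply: cnd.
  - by have := cab y; rewrite in_itv/= => /andP[].
  - apply: le_lt_trans (cB _ _ _) _ => //.
    by rewrite ltrBlDl; near: y; apply: nbhs_right_lt; rewrite ltrDl.
pose F : cumulative R R := HB.pack G (isCumulative.Build R _ R G Gnd Grc).
have FE x : a <= x <= b -> F x = g x by move=> xab; rewrite /F/= /G/= cE.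
pose nuF : {measure set (measurableTypeR R) -> \bar R} :=
  lebesgue_stieltjes_measure F.
have mab : measurable (`]a, b]%classic : set (measurableTypeR R)).
  exact: measurable_itv.
have nuab : (nuF `]a, b]%classic < +oo)%E.
  by rewrite [ltLHS] lebesgue_stieltjes_itvoc ?ltW// ltry.
pose nu : {finite_measure set (measurableTypeR R) -> \bar R} :=
  mfrestr mab nuab.
have dom : nu `<< mu.
  apply/null_content_dominatesP => N mN N0.
  exact: (abs_continuous_null ac FE).
have [f [f0 ffin intf fE]] := radon_nikodym_sigma_finite dom.
have mf : measurable_fun setT f by exact: measurable_int intf.
have fr0 x : 0 <= (fine \o f) x by exact: fine_ge0.
have mfr : measurable_fun setT (fine \o f) by exact: measurableT_comp.
(* The function [f] is finite everywhere, so [fine] loses nothing; the cut-off makes integrals from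
   -oo start at [a]. *)
pose rho := (fine \o f) \_ `]a, b].
have rhoE x : (rho x)%:E = (f \_ `]a, b]) x.
  by rewrite /rho !patchE; case: ifP => // _; rewrite /= fineK.
exists rho; split.
- by apply/(measurable_restrictT _ _).1 => //; exact: measurable_funTS.
- by move=> x; rewrite /rho patchE; case: ifP.
- under eq_integral do rewrite rhoE.
  rewrite -integral_mkcond -fE//.
  by rewrite -[ltLHS]/(nuF (`]a, b] `&` `]a, b])) setIid.
- by move=> x nx; rewrite /rho patchE memNset.
- move=> x ax xb; under eq_integral do rewrite rhoE.
  rewrite -integral_mkcondr -fE; last exact: measurableI.
  rewrite -[LHS]/(nuF (`]-oo, x] `&` `]a, b] `&` `]a, b])) -setIA setIid.
  have -> : `]-oo, x] `&` `]a, b] = `]a, x]%classic.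
    apply/seteqP; split => t /=; rewrite !in_itv/=.
      by move=> [-> /andP[->]].
    by move=> /andP[-> tx]; rewrite tx (le_trans tx xb).
  rewrite [LHS]lebesgue_stieltjes_itvoc// !FE ?ax ?xb ?lexx ?(ltW ab)//.
Unshelve. all: by end_near. Qed.

End stieltjes_density.

(** * The exponential-integral kernel *)

Section kernel.
Context {R : realType}.
Notation mu := (@lebesgue_measure R).
Local Open Scope ereal_scope.

Lemma ae_imply (P Q : R -> Prop) : (forall x, P x -> Q x) ->
  {ae mu, forall x, P x} -> {ae mu, forall x, Q x}.
Proof. by move=> PQ; apply: filterS; first exact: (ae_filter_ringOfSetsType mu). Qed.

Lemma tonelli_lebesgue (f : R -> R -> \bar R) :
  measurable_fun [set: R * R] (fun z => f z.1 z.2) -> (forall x y, 0 <= f x y) ->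
  \int[mu]_x \int[mu]_y f x y = \int[mu]_y \int[mu]_x f x y.
Proof.
move=> mf f0.
exact: (@fubini_tonelli _ _ _ _ _ mu mu (fun z => f z.1 z.2)).
Qed.

Lemma measurable_fun_integral_lebesgue (f : R -> R -> \bar R) :
  measurable_fun [set: R * R] (fun z => f z.1 z.2) -> (forall x y, 0 <= f x y) ->
  measurable_fun [set: R] (fun y => \int[mu]_x f x y).
Proof.
move=> mf f0.
exact: (@measurable_fun_fubini_tonelli_G _ _ _ _ _ mu (fun z => f z.1 z.2)).
Qed.

Section reflection.

Lemma measurable_subrl (c : R) : measurable_fun [set: R] (fun x : R => c - x)%R.
Proof. by apply: measurable_funB. Qed.

Let reflect (c : R) : R -> measurableTypeR R := (fun x => c - x)%R.
Let measurable_reflect c : measurable_fun [set: R] (reflect c).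
Proof. exact: measurable_subrl. Qed.

(** By uniqueness of Lebesgue measure it suffices to test half-open intervals, which the reflection
    maps to half-open intervals of equal length. *)
Lemma lebesgue_measure_reflect (c : R) (A : set R) : measurable A ->
  mu ((fun x => c - x)%R @^-1` A) = mu A.
Proof.
move=> mA; rewrite -[LHS]/(pushforward mu (reflect c) A).
apply/esym/lebesgue_measure_unique => //= [|mr _ [[p q]] _ <-].
  exact: measurable_reflect.
rewrite /pushforward.
have -> : reflect c @^-1` `]p, q] = `[(c - q)%R, (c - p)%R[%classic.
  apply/seteqP; split => x /=; rewrite /reflect !in_itv/= => /andP[h1 h2];
    by apply/andP; split; lra.
rewrite !lebesgue_measure_itv/= !lte_fin ltrD2l ltrN2.
by case: ifP => // _; rewrite -!EFinB; congr _%:E; lra.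
Qed.

Lemma ge0_integral_reflect (c : R) (D : set R) (g : R -> \bar R) : measurable D ->
  measurable_fun D g -> (forall x, D x -> 0 <= g x) ->
  \int[mu]_(x in (fun x => c - x)%R @^-1` D) g (c - x)%R = \int[mu]_(x in D) g x.
Proof.
move=> mD mg g0.
have mr := measurable_reflect c.
transitivity (\int[pushforward mu (reflect c)]_(x in D) g x); last first.
  by apply: eq_measure_integral => A mA _; exact: lebesgue_measure_reflect.
rewrite ge0_integral_pushforward//.
by move=> y /[!inE]; exact: g0.
Qed.

End reflection.



Definition frac_kernel (alpha u : R) : R :=
  if (0 < u)%R then (alpha^-1 * expint1 (u / alpha))%R else 0%R.

Let phi (alpha t : R) : R :=
  if (0 < t)%R then (expR (- t) / (alpha * t))%R else 0%R.

(** Integrated over [t], this gives [frac_kernel alpha u]. The range [u / alpha <= t] of the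
    integral defining E_1 is written so that, for fixed [t], it is an interval of values of [u]. *)
Let w (alpha t u : R) : R :=
  if ((0 < u) && (u <= alpha * t))%R then phi alpha t else 0%R.

Section positive_order.
Variable alpha : R.
Hypothesis alpha0 : (0 < alpha)%R.

Let phi_ge0 t : (0 <= phi alpha t)%R.
Proof.
by rewrite /phi; case: ifPn => // t0; rewrite divr_ge0 ?expR_ge0// mulr_ge0 ?ltW.
Qed.

Let measurable_phi : measurable_fun [set: R] (phi alpha).
Proof.
(* The library has no measurability lemma for the inverse, only for powers. *)
rewrite (_ : phi alpha = fun t => if (0 < t)%R then
    (expR (- t) * (alpha * t) `^ (-1))%R else 0%R); last first.
  apply/funext => t; rewrite /phi; case: ifPn => // t0.
  by rewrite powR_inv1// mulr_ge0// ltW.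
apply: measurable_fun_ifT => //; first exact: measurable_fun_ltr.
apply: measurable_funM; first by apply: measurableT_comp.
apply: (measurableT_comp (measurable_powR (-1))).
exact: measurable_funM.
Qed.

Lemma measurable_mixture_weight :
  measurable_fun (`]0%R, +oo[ : set R) (fun t : R => expR (- t) / (alpha * t))%R.
Proof.
apply: (@eq_measurable_fun _ _ _ _ _ (phi alpha)); last exact: measurable_funTS.
by move=> t /[!inE]/=; rewrite in_itv/= andbT /phi => ->.
Qed.

Let w_ge0 t u : (0 <= w alpha t u)%R.
Proof. by rewrite /w; case: ifP. Qed.

Let measurable_w : measurable_fun [set: R * R] (fun z => w alpha z.1 z.2).
Proof.
apply: measurable_fun_ifT => //; last exact: measurableT_comp.
apply: measurable_and; first exact: measurable_fun_ltr.
by apply: measurable_fun_ler => //; exact: measurable_funM.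
Qed.

Lemma integral_expRN : \int[mu]_(t in `]0%R, +oo[) (expR (- t))%:E = 1.
Proof.
rewrite -(integral_exponential_pdf (@ltr01 R)).
transitivity (\int[mu]_(t in `[0%R, +oo[) (expR (- t))%:E).
  apply: integral_itv_obnd_cbnd; apply/measurable_EFinP.
  by apply: measurable_funTS; apply: measurableT_comp.
rewrite integral_mkcond; apply: eq_integral => t _.
rewrite /exponential_pdf !patchE; case: ifP => // _.
by rewrite mul1r mulN1r.
Qed.

(** Passing from the real-valued [expint1] to an extended integral requires E_1 to be finite at
    [u / alpha]. *)
Lemma frac_kernelE u : (frac_kernel alpha u)%:E = \int[mu]_t (w alpha t u)%:E.
Proof.
rewrite /frac_kernel; case: ifPn => [u0|u0]; last first.
  by rewrite integral0_eq// => t _; rewrite /w/= (negPf u0).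
have ua0 : (0 < u / alpha)%R by rewrite divr_gt0.
have wE t : (w alpha t u)%:E =
    ((fun t => (alpha^-1)%:E * (expR (- t) / t)%:E) \_ `[(u / alpha)%R, +oo[) t.
  rewrite patchE; rewrite /w /phi/= u0/=.
  have -> : (t \in `[(u / alpha)%R, +oo[%classic) = (u <= alpha * t)%R.
    by rewrite mem_setE in_itv/= andbT ler_pdivrMr// mulrC.
  case: ifPn => // uat; have t0 : (0 < t)%R.
    by rewrite -(pmulr_rgt0 _ alpha0); exact: lt_le_trans uat.
  by rewrite t0 -EFinM invfM mulrCA mulrA.
under eq_integral do rewrite wE.
have mf : measurable_fun `[(u / alpha)%R, +oo[ (fun t => (expR (- t) / t)%:E).
  apply: (@eq_measurable_fun _ _ _ _ _ (EFin \o (fun t => alpha * phi alpha t)%R)).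
    move=> t /[!inE]/=; rewrite in_itv/= andbT => ut.
    have t0 := lt_le_trans ua0 ut; rewrite /phi t0; congr _%:E.
    by field; rewrite !gt_eqF.
  by apply/measurable_EFinP/measurable_funTS/measurable_funM.
have f0 t : `[(u / alpha)%R, +oo[%classic t -> 0 <= (expR (- t) / t)%:E.
  rewrite /= in_itv/= andbT => ut.
  by rewrite lee_fin divr_ge0 ?expR_ge0// (le_trans (ltW ua0)).
rewrite -integral_mkcond ge0_integralZl_EFin//=; last by rewrite invr_ge0 ltW.
rewrite EFinM /expint1 /Rintegral fineK// ge0_fin_numE ?integral_ge0//.
have mexp : measurable_fun [set: R] (fun t : R => expR (- t))%R.
  exact: measurableT_comp.
(* On the domain, [1 / t] is at most the inverse of [u / alpha], which leaves a multiple of the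
   integral of e^-t. *)
apply: (@le_lt_trans _ _ (\int[mu]_(t in `[(u / alpha)%R, +oo[)
    ((u / alpha)^-1%:E * (expR (- t))%:E))).
  apply: ge0_le_integral => //.
  - by apply: measurable_funeM; exact/measurable_EFinP/measurable_funTS.
  - move=> t /=; rewrite in_itv/= andbT => ut.
    rewrite -EFinM lee_fin mulrC ler_wpM2r ?expR_ge0//.
    by rewrite lef_pV2 ?posrE// (lt_le_trans ua0).
rewrite ge0_integralZl_EFin//=; last 2 first.
- exact/measurable_EFinP/measurable_funTS.
- by rewrite invr_ge0 ltW.
apply: (@le_lt_trans _ _ ((u / alpha)^-1%:E * 1)); last by rewrite mule1 ltry.
apply: lee_wpmul2l; first by rewrite lee_fin invr_ge0 ltW.
rewrite -integral_expRN; apply: ge0_subset_integral => //.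
- exact/measurable_EFinP/measurable_funTS.
- by move=> t /=; rewrite !in_itv/= !andbT; exact: lt_le_trans.
Qed.

Lemma frac_kernel_ge0 u : (0 <= frac_kernel alpha u)%R.
Proof.
by rewrite -lee_fin frac_kernelE; apply: integral_ge0 => t _; rewrite lee_fin.
Qed.

Lemma measurable_frac_kernel : measurable_fun [set: R] (frac_kernel alpha).
Proof.
apply/measurable_EFinP; rewrite (_ : EFin \o _ = fun u => \int[mu]_t (w alpha t u)%:E).
  apply: measurable_fun_integral_lebesgue => [|t u]; last by rewrite lee_fin.
  exact/measurable_EFinP.
by apply/funext => u; exact: frac_kernelE.
Qed.

(* Tonelli, from k(u) = int_(t >= u / alpha) e^-t / (alpha t) dt. *)
Lemma frac_kernel_mixture (g : R -> \bar R) :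
  measurable_fun [set: R] g -> (forall u, 0 <= g u) ->
  \int[mu]_u ((frac_kernel alpha u)%:E * g u) =
  \int[mu]_(t in `]0%R, +oo[)
    ((expR (- t) / (alpha * t))%:E * \int[mu]_(u in `]0%R, (alpha * t)%R]) g u).
Proof.
move=> mg g0.
pose f t u := (w alpha t u)%:E * g u.
transitivity (\int[mu]_u \int[mu]_t f t u).
  apply: eq_integral => u _; rewrite frac_kernelE -ge0_integralZr//.
    by apply/measurable_EFinP; exact: (measurable_fun_pair1 u measurable_w).
  by move=> t _; rewrite lee_fin.
rewrite -(tonelli_lebesgue (f := f)); last 2 first.
- apply: emeasurable_funM; first exact/measurable_EFinP.
  exact: (measurableT_comp mg measurable_snd).
- by move=> t u; rewrite mule_ge0// lee_fin.
rewrite [RHS]integral_mkcond; apply: eq_integral => t _.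
rewrite patchE mem_setE in_itv/= andbT.
have fE u : f t u = (phi alpha t)%:E * (g \_ `]0%R, (alpha * t)%R]) u.
  rewrite /f /w/= patchE mem_setE in_itv/=.
  by case: ifPn => // _; rewrite mul0e mule0.
under eq_integral do rewrite fE.
rewrite ge0_integralZl_EFin//; last 2 first.
- by move=> u _; rewrite erestrict_ge0.
- by apply/(measurable_restrictT _ _).1 => //; exact: measurable_funTS.
by rewrite -integral_mkcond /phi; case: ifPn => // _; rewrite mul0e.
Qed.

(** In the mixture formula with constant 1, the inner integral [alpha * t] cancels the denominator
    of the weight and e^-t remains. *)
Lemma integral_frac_kernel : \int[mu]_u (frac_kernel alpha u)%:E = 1.
Proof.
under eq_integral do rewrite -[_%:E]mule1.
rewrite (@frac_kernel_mixture (cst 1))//.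
rewrite -[RHS]integral_expRN; apply: eq_integral => t /[!inE]/=.
rewrite in_itv/= andbT => t0; have at0 : (0 < alpha * t)%R by rewrite mulr_gt0.
have -> : \int[mu]_(u in `]0%R, (alpha * t)%R]) 1 = (alpha * t)%:E.
  rewrite integral_cst// mul1e/= lebesgue_measure_itv/= lte_fin at0.
  by rewrite sube0.
by rewrite -EFinM divfK// gt_eqF.
Qed.

End positive_order.

End kernel.

(** * Convolution of a nonnegative density with the kernel *)

Section convolution.
Context {R : realType}.
Notation mu := (@lebesgue_measure R).
Local Open Scope ereal_scope.

(** A translation is the composite of the reflections x |-> c - x and z |-> 0 - z. *)
Lemma ge0_integral_translate (c : R) (D : set R) (g : R -> \bar R) : measurable D ->
  measurable_fun D g -> (forall x, D x -> 0 <= g x) ->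
  \int[mu]_(x in (fun x => x - c)%R @^-1` D) g (x - c)%R = \int[mu]_(x in D) g x.
Proof.
move=> mD mg g0.
have mN (A : set R) : measurable A -> measurable ((fun x => 0 - x)%R @^-1` A).
  by move=> mA; rewrite -[X in measurable X]setTI; exact: (measurable_subrl 0).
pose D' := (fun x => 0 - x)%R @^-1` D; pose h z := g (0 - z)%R.
have mh : measurable_fun D' h.
  apply: (measurable_comp mD) => //; first by move=> _ [x D'x <-].
  exact: measurable_funS (measurable_subrl 0).
rewrite -(ge0_integral_reflect 0 mD mg g0).
rewrite -(@ge0_integral_reflect _ c D' h)//; last 2 first.
- exact: mN.
- by move=> x; exact: g0.
rewrite /D' /h; under [RHS]eq_integral do rewrite sub0r opprB.
by congr (integral _ _ _); apply/seteqP; split => x /=; rewrite sub0r opprB.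
Qed.

(** Extended values allow Tonelli and Fatou to be applied without first discarding points where the
    convolution is infinite. *)
Definition frac_conv (alpha : R) (rho : R -> R) (y : R) : \bar R :=
  \int[mu]_u (frac_kernel alpha u * rho (y - u))%:E.

Section positive_order.
Variables (alpha : R) (rho : R -> R).
Hypothesis alpha0 : (0 < alpha)%R.
Hypothesis mrho : measurable_fun [set: R] rho.
Hypothesis rho0 : forall x, (0 <= rho x)%R.

Let measurable_shift : measurable_fun [set: R * R] (fun z => rho (z.2 - z.1)%R).
Proof. by apply: (measurableT_comp mrho); exact: measurable_funB. Qed.

Let measurable_kernel : measurable_fun [set: R * R] (fun z => frac_kernel alpha z.1).
Proof. exact: (measurableT_comp (measurable_frac_kernel alpha0)). Qed.

Lemma frac_conv_ge0 y : 0 <= frac_conv alpha rho y.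
Proof.
by apply: integral_ge0 => u _; rewrite lee_fin mulr_ge0// frac_kernel_ge0.
Qed.

Lemma measurable_frac_conv : measurable_fun [set: R] (frac_conv alpha rho).
Proof.
apply: (measurable_fun_integral_lebesgue
  (f := fun u y => (frac_kernel alpha u * rho (y - u))%:E)).
  by apply/measurable_EFinP; apply: measurable_funM.
by move=> u y; rewrite lee_fin mulr_ge0// frac_kernel_ge0.
Qed.

(** Tonelli, then a translation by [u] in the inner integral. The whole line as [A] gives
    conservation of mass; a left half-line gives the primitive of the convolution. *)
Lemma integral_frac_conv (A : set R) : measurable A ->
  \int[mu]_(y in A) frac_conv alpha rho y =
  \int[mu]_u ((frac_kernel alpha u)%:E *
    \int[mu]_(s in (fun s => s + u)%R @^-1` A) (rho s)%:E).
Proof.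
move=> mA; pose F u y := (frac_kernel alpha u * (\1_A y * rho (y - u)))%:E.
have F0 u y : 0 <= F u y.
  by rewrite lee_fin !mulr_ge0// frac_kernel_ge0.
have mF : measurable_fun [set: R * R] (fun z => F z.1 z.2).
  apply/measurable_EFinP; apply: measurable_funM => //.
  apply: measurable_funM => //.
  by apply: (measurableT_comp (measurable_indic mA)).
transitivity (\int[mu]_y \int[mu]_u F u y).
  rewrite integral_mkcond; apply: eq_integral => y _; rewrite patchE /F indicE.
  case: ifPn => yA; first by apply: eq_integral => u _; rewrite mul1r.
  by rewrite integral0_eq// => u _; rewrite mulr0n mul0r mulr0.
rewrite -(tonelli_lebesgue mF F0); apply: eq_integral => u _.
have mAu : measurable ((fun s => s + u)%R @^-1` A).
  by rewrite -[X in measurable X]setTI; apply: measurable_funD.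
rewrite -(ge0_integral_translate u mAu); last 2 first.
- exact/measurable_EFinP/measurable_funTS.
- by move=> x _; rewrite lee_fin.
rewrite -ge0_integralZl_EFin//; last 4 first.
- by rewrite -[X in measurable X]setTI; exact: measurable_funB.
- by move=> x _; rewrite lee_fin.
- apply/measurable_EFinP/measurable_funTS; apply: (measurableT_comp mrho).
  exact: measurable_funB.
- exact: frac_kernel_ge0.
rewrite [RHS]integral_mkcond; apply: eq_integral => y _; rewrite /F patchE indicE.
have -> : (y \in (fun x => x - u)%R @^-1` ((fun s => s + u)%R @^-1` A)) = (y \in A).
  by apply/idP/idP; rewrite !inE /= subrK.
case: ifP => _; first by rewrite mulr1n mul1r EFinM.
by rewrite mulr0n mul0r mulr0.
Qed.

Lemma integral_frac_convT : \int[mu]_y frac_conv alpha rho y = \int[mu]_y (rho y)%:E.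
Proof.
rewrite integral_frac_conv//; under eq_integral do rewrite preimage_setT.
rewrite ge0_integralZr//; last 2 first.
- by move=> u _; rewrite lee_fin frac_kernel_ge0.
- by apply: integral_ge0 => u _; rewrite lee_fin.
- by rewrite integral_frac_kernel// mul1e.
by apply/measurable_EFinP; exact: measurable_frac_kernel.
Qed.

(** The mixture formula applied to u |-> rho (y - u); reflecting the inner variable produces the
    increment of a primitive of [rho] to the left of [y]. *)
Lemma frac_conv_mixture y : frac_conv alpha rho y =
  \int[mu]_(t in `]0%R, +oo[) ((expR (- t) / (alpha * t))%:E *
    \int[mu]_(s in `[(y - alpha * t)%R, y[) (rho s)%:E).
Proof.
have mr : measurable_fun [set: R] (fun u => (rho (y - u))%:E).
  apply/measurable_EFinP; apply: (measurableT_comp mrho); exact: measurable_subrl.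
rewrite /frac_conv; under eq_integral do rewrite EFinM.
rewrite frac_kernel_mixture//; last by move=> u; rewrite lee_fin.
apply: eq_integral => t _; congr (_ * _).
rewrite -[RHS](@ge0_integral_reflect _ y); last 3 first.
- exact: measurable_itv.
- exact/measurable_EFinP/measurable_funTS.
- by move=> x _; rewrite lee_fin.
congr (integral _ _ _); apply/seteqP; split => u /=; rewrite !in_itv/=.
  by move=> /andP[h1 h2]; apply/andP; split; lra.
by move=> /andP[h1 h2]; apply/andP; split; lra.
Qed.

End positive_order.

End convolution.

(** * Convergence of densities *)

Section scheffe.
Context {R : realType}.
Notation mu := (@lebesgue_measure R).
Local Open Scope ereal_scope.

Lemma limn_einf_gt (u : (\bar R)^nat) (c : \bar R) :
  c < limn_einf u -> \forall n \near \oo, c < u n.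
Proof.
rewrite limn_einf_lim.
have -> : limn (einfs u) = ereal_sup (range (einfs u)).
  by apply/cvg_lim => //; apply: ereal_nondecreasing_cvgn; exact: nondecreasing_einfs.
case/ereal_sup_gt => _ [n _ <-] cn; exists n => // m /= nm.
by apply: lt_le_trans cn _; apply: ereal_inf_lbound; exists m.
Qed.

(** The positive part of [r - d n] is dominated by [r], and the lower bound on the limit inferior
    sends it to 0 a.e. Equality of the integrals then controls the negative part as well. *)
Lemma scheffe (d : nat -> R -> \bar R) (r : R -> R) :
  (forall n, measurable_fun [set: R] (d n)) -> (forall n x, 0 <= d n x) ->
  measurable_fun [set: R] r -> (forall x, (0 <= r x)%R) ->
  \int[mu]_x (r x)%:E < +oo ->
  (forall n, \int[mu]_x d n x = \int[mu]_x (r x)%:E) ->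
  {ae mu, forall x, (r x)%:E <= limn_einf (fun n => d n x)} ->
  \int[mu]_x `|d n x - (r x)%:E| @[n --> \oo] --> 0.
Proof.
move=> md d0 mr r0 intr intd ae_le.
pose g n x := maxe ((r x)%:E - d n x) 0.
have mEr : measurable_fun [set: R] (fun x => (r x)%:E) by exact/measurable_EFinP.
have mg n : measurable_fun [set: R] (g n).
  by apply: measurable_maxe => //; exact: emeasurable_funB.
have g0 n x : 0 <= g n x by rewrite /g le_max lexx orbT.
have gr n x : g n x <= (r x)%:E.
  rewrite /g ge_max lee_fin r0 andbT; move: (d0 n x); case: (d n x) => [e| |]//=.
  - by rewrite lee_fin => e0; rewrite lee_fin lerBlDr lerDl.
  - by rewrite addeNy leNye.
have ir : mu.-integrable [set: R] (fun x => (r x)%:E).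
  apply/integrableP; split => //.
  by under eq_integral do rewrite gee0_abs ?lee_fin//.
have gcvg : {ae mu, forall x, [set: R] x -> g ^~ x @ \oo --> 0}.
  apply: ae_imply ae_le => x xle _.
  have gfin n : g n x \is a fin_num.
    by rewrite ge0_fin_numE//; exact: le_lt_trans (gr n x) (ltry _).
  apply/fine_cvgP; split; first exact: nearW.
  apply/cvgrPdist_le => e e0.
  have : (r x - e)%:E < limn_einf (fun n => d n x).
    by apply: lt_le_trans xle; rewrite lte_fin ltrBlDr ltrDl.
  move=> /limn_einf_gt; apply: filterS => n rd.
  rewrite sub0r normrN ger0_norm; last exact: fine_ge0.
  rewrite -lee_fin fineK// /g ge_max lee_fin (ltW e0) andbT.
  move: rd; case: (d n x) => [y| |]//=.
  - by rewrite lte_fin lee_fin; lra.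
  - by rewrite addeNy leNye.
have intg : \int[mu]_x g n x @[n --> \oo] --> 0.
  have -> : 0 = \int[mu]_x cst 0 x :> \bar R by rewrite integral0.
  have [] // := @dominated_convergence _ _ _ mu setT measurableT g (cst 0)
    (fun x => (r x)%:E).
  by apply: aeW => x n _; rewrite gee0_abs.
(* |d - r| + r = d + 2 (r - d)^+, and d and r have the same integral. *)
have E n : \int[mu]_x `|d n x - (r x)%:E| = 2%:E * \int[mu]_x g n x.
  have key x : `|d n x - (r x)%:E| + (r x)%:E = d n x + 2%:E * g n x.
    rewrite /g; move: (d0 n x) (r0 x); case: (d n x) => [e| |]//=.
      rewrite lee_fin => e0 rx0.
      rewrite -!EFinB -EFin_max -EFinM /= -!EFinD; congr _%:E.
      by case: (leP (r x - e)%R 0%R) => h; [rewrite ger0_norm|rewrite ltr0_norm]; lra.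
    by move=> _ _; rewrite addeNy maxNye mule0 !addye.
  have mabs : measurable_fun [set: R] (fun x => `|d n x - (r x)%:E|).
    by apply: measurableT_comp => //; exact: emeasurable_funB.
  have : \int[mu]_x `|d n x - (r x)%:E| + \int[mu]_x (r x)%:E =
      \int[mu]_x (r x)%:E + 2%:E * \int[mu]_x g n x.
    rewrite -ge0_integralD//; last by move=> x _; rewrite lee_fin.
    under eq_integral do rewrite key.
    rewrite ge0_integralD//; last 3 first.
    - exact: md.
    - by move=> x _; rewrite mule_ge0.
    - by apply: measurable_funeM; exact: mg.
    rewrite intd ge0_integralZl//; exact: mg.
  have fr : \int[mu]_x (r x)%:E \is a fin_num by exact: integrable_fin_num.
  by rewrite [RHS]addeC => /(congr1 (fun z => z - \int[mu]_x (r x)%:E)); rewrite !addeK.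
have : (fun n => 2%:E * \int[mu]_x g n x) @ \oo --> 2%:E * 0 by exact: cvgeZl.
by rewrite mule0; under eq_cvg do rewrite -E.
Qed.
End scheffe.

(** * Primitives of nonnegative integrable densities *)

Section primitive.
Context {R : realType}.
Notation mu := (@lebesgue_measure R).
Variable rho : R -> R.
Hypothesis mrho : measurable_fun [set: R] rho.
Hypothesis rho0 : forall x, 0 <= rho x.
Hypothesis irho : (\int[mu]_x (rho x)%:E < +oo)%E.

Definition primitive (f : R -> R) (x : R) : R := \int[mu]_(t in `]-oo, x]) f t.

Lemma integrable_density : mu.-integrable [set: R] (EFin \o rho).
Proof.
apply/integrableP; split; first exact/measurable_EFinP.
by under eq_integral do rewrite /= ger0_norm//.
Qed.

Lemma primitiveE z : (primitive rho z)%:E = (\int[mu]_(t in `]-oo, z]) (rho t)%:E)%E.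
Proof.
rewrite /primitive /Rintegral fineK//; apply: integrable_fin_num => //.
by apply: (integrableS measurableT) => //; exact: integrable_density.
Qed.

Lemma primitive_ge0 z : 0 <= primitive rho z.
Proof. by rewrite -lee_fin primitiveE integral_ge0// => t _; rewrite lee_fin. Qed.

Lemma primitiveB y h : 0 < h ->
  (\int[mu]_(s in `[(y - h)%R, y[) (rho s)%:E)%E =
  (primitive rho y - primitive rho (y - h))%:E.
Proof.
move=> h0; have mEr (D : set R) : measurable_fun D (fun s => (rho s)%:E).
  exact/measurable_EFinP/measurable_funTS.
rewrite integral_itv_bndo_bndc// -integral_itv_obnd_cbnd//.
rewrite EFinB !primitiveE.
rewrite [X in (_ = X - _)%E](_ : _ = (\int[mu]_(t in `]-oo, (y - h)%R]) (rho t)%:E +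
   \int[mu]_(s in `](y - h)%R, y]) (rho s)%:E)%E).
  rewrite addeAC subee ?add0e// -primitiveE//.
rewrite -ge0_integral_setU//=.
- congr (integral _ _ _); rewrite -itv_bndbnd_setU//= bnd_simp.
  by rewrite lerBlDr lerDl ltW.
- exact: mEr.
- by move=> x _; rewrite lee_fin.
- apply/disj_setPRL => z /=; rewrite !in_itv/= => /andP[h1 _].
  by apply/negP; rewrite -ltNge.
Qed.

Lemma primitive_derivable :
  {ae mu, forall x, is_derive x (1 : R) (primitive rho) (rho x)}.
Proof.
have loc : locally_integrable [set: R] rho.
  by apply: open_integrable_locally => //; [exact: openT|exact: integrable_density].
have intN y : mu.-integrable `]-oo, y] (EFin \o rho).
  by apply: (integrableS measurableT) => //; exact: integrable_density.
apply: ae_imply (FTC1Ny intN loc) => x [dx Ex]; split => //.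
by rewrite -derive1E.
Qed.

(** The two-sided difference quotient sampled along the nonzero increments [- h n]. *)
Lemma is_derive_left_quotient (f : R -> R) (y l : R) (h : nat -> R) :
  is_derive y 1 f l -> (forall n, 0 < h n) -> h n @[n --> \oo] --> (0 : R) ->
  (f y - f (y - h n)) / h n @[n --> \oo] --> l.
Proof.
move=> [dy <-] h0 hcvg.
have /cvgr_dnbhsP/(_ (fun n => - h n)) H :
    k^-1 *: (f (k *: 1 + y) - f y) @[k --> 0^'] --> 'D_1 f y.
  exact: dy.
rewrite [X in X @ _ --> _](_ : _ =
    fun n => (- h n)^-1 *: (f (- h n *: 1 + y) - f y)).
  apply: H; split; first by move=> n; rewrite oppr_eq0 gt_eqF.
  by rewrite -oppr0; exact: cvgN.
apply/funext => n /=; rewrite /GRing.scale/= mulr1 (addrC (- h n) y).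
by rewrite invrN mulNr -mulrN opprB mulrC.
Qed.

Lemma measurable_primitive : measurable_fun [set: R] (primitive rho).
Proof.
apply: nondecreasing_measurable => // u v uv.
rewrite -lee_fin !primitiveE; apply: ge0_subset_integral => //.
- exact/measurable_EFinP/measurable_funTS.
- by move=> t _; rewrite lee_fin.
- by move=> t /=; rewrite !in_itv/= => /le_trans; apply.
Qed.

(** Fatou in the mixture formula: for each fixed [t] the left quotient with step [alpha n * t] tends
    to [rho y], and the weights e^-t have total mass 1. The resulting one-sided bound is what
    [scheffe] takes as input. *)
Lemma limn_einf_frac_conv (y : R) (alpha : nat -> R) :
  is_derive y 1 (primitive rho) (rho y) -> (forall n, 0 < alpha n) ->
  alpha n @[n --> \oo] --> (0 : R) ->
  ((rho y)%:E <= limn_einf (fun n => frac_conv (alpha n) rho y))%E.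
Proof.
move=> dy a0 acvg.
have mP := measurable_primitive.
pose F n t := ((expR (- t) / (alpha n * t)) *
   (primitive rho y - primitive rho (y - alpha n * t)))%:E.
have D0 (t : R) : `]0, +oo[%classic t -> 0 < t by rewrite /= in_itv/= andbT.
have F0 n (t : R) : `]0, +oo[%classic t -> (0 <= F n t)%E.
  move=> /D0 t0; rewrite /F EFinM -primitiveB ?mulr_gt0//; apply: mule_ge0.
    by rewrite lee_fin divr_ge0 ?expR_ge0// mulr_ge0 ?ltW.
  by apply: integral_ge0 => s _; rewrite lee_fin.
have mF n : measurable_fun (`]0, +oo[ : set R) (F n).
  apply/measurable_EFinP; apply: measurable_funM.
    exact: measurable_mixture_weight.
  apply: measurable_funB => //; apply: measurable_funTS.
  by apply: (measurableT_comp mP); apply: measurable_funB => //; exact: measurable_funM.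
have := fatou mu (measurable_itv `]0%R, +oo[) mF F0.
rewrite [X in (X <= _)%E -> _](_ : _ = (rho y)%:E); last first.
  transitivity (\int[mu]_(t in `]0%R, +oo[) ((rho y)%:E * (expR (- t))%:E))%E.
    apply: eq_integral => t /[!inE] /D0 t0.
    have atc : alpha n * t @[n --> \oo] --> (0 : R).
      by rewrite -(mul0r t); exact: cvgMr_tmp.
    have Fc : (fun n => F n t) @ \oo --> ((rho y)%:E * (expR (- t))%:E)%E.
      rewrite -EFinM; apply/fine_cvgP; split; first exact: nearW.
      have -> : fine \o (fun n => F n t) = (fun n => expR (- t) *
          ((primitive rho y - primitive rho (y - alpha n * t)) / (alpha n * t))).
        by apply/funext => n /=; rewrite mulrAC mulrA.
      rewrite /= [X in _ --> X]mulrC; apply: cvgMl_tmp.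
      exact: (is_derive_left_quotient dy (fun n => mulr_gt0 (a0 n) t0) atc).
    have [-> _] := cvg_limn_einf_sup Fc.
    by [].
  rewrite ge0_integralZl_EFin//; last first.
    by apply/measurable_EFinP/measurable_funTS; apply: measurableT_comp.
  by rewrite integral_expRN mule1.
rewrite [X in (_ <= limn_einf X)%E -> _](_ : _ = fun n => frac_conv (alpha n) rho y)//.
apply/funext => n; rewrite frac_conv_mixture//; apply: eq_integral => t /[!inE] /D0 t0.
by rewrite primitiveB ?mulr_gt0// -EFinM.
Qed.

End primitive.

(** * The density of the fractional integral of a primitive *)

Section fractional_density.
Context {R : realType}.
Notation mu := (@lebesgue_measure R).
Variable rho : R -> R.
Hypothesis mrho : measurable_fun [set: R] rho.
Hypothesis rho0 : forall x, 0 <= rho x.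
Hypothesis irho : (\int[mu]_x (rho x)%:E < +oo)%E.

(** Where the convolution is infinite, [fine] returns 0; for integrable [rho] this happens only on a
    null set. *)
Definition frac_density (alpha x : R) : R := fine (frac_conv alpha rho x).

Lemma cvg_frac_conv (alpha : nat -> R) : (forall n, 0 < alpha n) ->
  alpha n @[n --> \oo] --> (0 : R) ->
  (\int[mu]_x `|frac_conv (alpha n) rho x - (rho x)%:E|)%E @[n --> \oo] --> 0%E.
Proof.
move=> a0 acvg; apply: scheffe => //.
- by move=> n; exact: measurable_frac_conv.
- by move=> n x; exact: frac_conv_ge0.
- by move=> n; exact: integral_frac_convT.
apply: ae_imply (primitive_derivable mrho rho0 irho) => x dx.
exact: limn_einf_frac_conv.
Qed.

Section fixed_order.
Variable alpha : R.
Hypothesis alpha0 : 0 < alpha.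

Lemma integrable_frac_conv : mu.-integrable [set: R] (frac_conv alpha rho).
Proof.
apply/integrableP; split; first exact: measurable_frac_conv.
under eq_integral do rewrite gee0_abs ?frac_conv_ge0//.
by rewrite integral_frac_convT.
Qed.

Lemma frac_density_ge0 x : 0 <= frac_density alpha x.
Proof. by apply: fine_ge0; exact: frac_conv_ge0. Qed.

Lemma measurable_frac_density : measurable_fun [set: R] (frac_density alpha).
Proof. by apply: measurableT_comp => //; exact: measurable_frac_conv. Qed.

Lemma frac_densityE :
  {ae mu, forall x, (frac_density alpha x)%:E = frac_conv alpha rho x}.
Proof.
apply: ae_imply (integrable_ae measurableT integrable_frac_conv).
by move=> x /(_ Logic.I) xfin; rewrite /frac_density fineK.
Qed.

Lemma integral_frac_density (A : set R) : measurable A ->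
  (\int[mu]_(x in A) (frac_density alpha x)%:E =
   \int[mu]_(x in A) frac_conv alpha rho x)%E.
Proof.
move=> mA; apply: ge0_ae_eq_integral => //.
- by apply/measurable_EFinP/measurable_funTS; exact: measurable_frac_density.
- by apply: measurable_funTS; exact: measurable_frac_conv.
- by move=> x _; rewrite lee_fin frac_density_ge0.
- by move=> x _; exact: frac_conv_ge0.
- by apply: ae_imply frac_densityE => x ->.
Qed.

Lemma integral_frac_densityT_lty : (\int[mu]_x (frac_density alpha x)%:E < +oo)%E.
Proof. by rewrite integral_frac_density// integral_frac_convT. Qed.

(** Taking primitives commutes with convolution by the kernel, because shifting the half-line up to
    [x] by [u] gives the half-line up to [x - u]. *)
Lemma primitive_frac_densityE x : (primitive (frac_density alpha) x)%:E =
  (\int[mu]_u ((frac_kernel alpha u)%:E * (primitive rho (x - u))%:E))%E.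
Proof.
rewrite primitiveE; last 3 first.
- exact: measurable_frac_density.
- exact: frac_density_ge0.
- exact: integral_frac_densityT_lty.
rewrite integral_frac_density// integral_frac_conv//.
apply: eq_integral => u _; rewrite primitiveE//; congr (_ * integral _ _ _)%E.
by apply/seteqP; split => s /=; rewrite !in_itv/= lerBrDr.
Qed.

Variable a : R.
Hypothesis rhoa : forall x, x <= a -> rho x = 0.

Lemma primitive_eq0 x : x <= a -> primitive rho x = 0.
Proof.
move=> xa; apply/EFin_inj; rewrite primitiveE// integral0_eq// => t /=.
by rewrite in_itv/= => tx; rewrite rhoa// (le_trans tx).
Qed.

(** After t |-> x - t, [left_J] is the convolution of the kernel with [primitive rho]: the kernel
    vanishes beyond [x] and the primitive before [a]. Integrability is recorded so that such
    integrals can be subtracted. *)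
Lemma integrable_left_J x : a <= x ->
  mu.-integrable `[a, x] (fun t => (expint1 ((x - t) / alpha) * primitive rho t)%:E) /\
  left_J a alpha (primitive rho) x = primitive (frac_density alpha) x.
Proof.
move=> ax; set h := fun t : R => expint1 ((x - t) / alpha) * primitive rho t.
have mP : measurable_fun [set: R] (primitive rho).
  exact: measurable_primitive.
have hE t : t < x -> h t = alpha * (frac_kernel alpha (x - t) * primitive rho t).
  move=> tx; rewrite /frac_kernel subr_gt0 tx /h -!mulrA mulrA.
  by rewrite divff ?gt_eqF// mul1r.
have mk : measurable_fun [set: R]
    (fun t : R => frac_kernel alpha (x - t) * primitive rho t).
  apply: measurable_funM => //.
  apply: (measurableT_comp (measurable_frac_kernel alpha0)).
  exact: measurable_subrl.
have k0 t : 0 <= frac_kernel alpha (x - t) * primitive rho t.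
  by rewrite mulr_ge0 ?frac_kernel_ge0 ?primitive_ge0.
(* The point [x] is left out, since [expint1 0] is a default value there; as a null set it is
   restored in [Eint']. *)
have mh : measurable_fun (`[a, x[ : set R) h.
  apply: (@eq_measurable_fun _ _ _ _ _
      (fun t : R => alpha * (frac_kernel alpha (x - t) * primitive rho t))).
    by move=> t /[!inE]/=; rewrite in_itv/= => /andP[_ tx]; rewrite hE.
  by apply: measurable_funTS; exact: measurable_funM.
have h0 t : `[a, x[%classic t -> 0 <= h t.
  by rewrite /= in_itv/= => /andP[_ tx]; rewrite hE// mulr_ge0// ltW.
have mh' : measurable_fun (`[a, x[ : set R) (EFin \o h) by exact/measurable_EFinP.
have Eint : (\int[mu]_(t in `[a, x[) (h t)%:E =
    alpha%:E * (primitive (frac_density alpha) x)%:E)%E.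
  rewrite primitive_frac_densityE.
  pose G u := ((frac_kernel alpha u)%:E * (primitive rho (x - u))%:E)%E.
  have G0 u : (0 <= G u)%E.
    by rewrite mule_ge0// lee_fin ?frac_kernel_ge0 ?primitive_ge0.
  have mG : measurable_fun [set: R] G.
    apply: emeasurable_funM; apply/measurable_EFinP.
      exact: measurable_frac_kernel.
    by apply: (measurableT_comp mP); exact: measurable_subrl.
  rewrite -[X in (_ = _ * X)%E](@ge0_integral_reflect _ x setT G)//.
  rewrite preimage_setT -ge0_integralZl_EFin//; last 2 first.
  - by apply: (measurableT_comp mG); exact: measurable_subrl.
  - exact: ltW.
  rewrite [LHS]integral_mkcond; apply: eq_integral => t _.
  rewrite patchE mem_setE in_itv/= /G subKr -!EFinM.
  case: ifPn => [/andP[_ tx]|]; first by rewrite hE.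
  rewrite negb_and -ltNge -leNgt => /orP[ta|xt].
    by rewrite primitive_eq0 ?mulr0// ltW.
  by rewrite /frac_kernel subr_gt0 ltNge xt/= mul0r mulr0.
have Eint' : (\int[mu]_(t in `[a, x]) (h t)%:E =
    (alpha * primitive (frac_density alpha) x)%:E)%E.
  by rewrite -integral_itv_bndo_bndc// Eint EFinM.
split.
  apply/integrableP; split.
    by apply/emeasurable_fun_itv_bndo_bndcP.
  rewrite -integral_itv_bndo_bndc; last exact: measurableT_comp.
  under eq_integral.
    by move=> t /[!inE] /h0 ht; rewrite gee0_abs; [over|rewrite lee_fin].
  by rewrite Eint -EFinM ltry.
rewrite /left_J /Rintegral -/h Eint'/= mulrA mulVf ?mul1r// gt_eqF//.
Qed.

(** The sum of the increments is the integral of [r] over the union of the intervals, which is small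
    when the measure of the union is. *)
Lemma abs_continuous_primitive (r : R -> R) (p q : R) : measurable_fun [set: R] r ->
  (forall x, 0 <= r x) -> (\int[mu]_x (r x)%:E < +oo)%E ->
  abs_continuous p q (primitive r).
Proof.
move=> mr r0 ir e e0.
have [d [d0 H]] := integral_normr_continuous (integrable_density mr r0 ir) e0.
exists d => // n u v uv tr uvd.
have mI i : measurable `[u i, v i[%classic by [].
pose A := \big[setU/set0]_(i < n) `]u i, v i[%classic.
have mA : measurable A by apply: bigsetU_measurable.
have muA : (mu A < d%:E)%E.
  rewrite measure_semi_additive_ord//.
  rewrite (eq_bigr (fun i => (v i - u i)%:E)) ?sumEFin ?lte_fin//.
  move=> i _; have [_ [uvi _]] := uv i.
  by rewrite /= lebesgue_measure_itv/= lte_fin uvi EFinB.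
have := H A mA muA; under eq_Rintegral do rewrite ger0_norm//.
apply: le_lt_trans.
rewrite -lee_fin /Rintegral fineK; last first.
  apply: integrable_fin_num => //.
  by apply: (integrableS measurableT) => //; exact: integrable_density.
rewrite ge0_integral_bigsetU//=; last 4 first.
- exact: index_enum_uniq.
- exact: sub_trivIset tr.
- exact/measurable_EFinP/measurable_funTS.
- by move=> x _; rewrite lee_fin.
rewrite -sumEFin; apply: lee_sum => i _; have [_ [uvi _]] := uv i.
have := primitiveB mr r0 ir (v i) (h := v i - u i).
have -> : v i - (v i - u i) = u i by ring.
rewrite subr_gt0 => /(_ uvi) E.
rewrite integral_itv_obnd_cbnd; last exact/measurable_EFinP/measurable_funTS.
rewrite [leRHS]E lee_fin ger0_norm// -lee_fin -E.
by apply: integral_ge0 => x _; rewrite lee_fin.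
Qed.


End fixed_order.
End fractional_density.

(** * Fractional derivatives of small order *)

Section frac_limit.
Context {R : realType}.
Notation mu := (@lebesgue_measure R).

Import HBNNSimple.

(* f is not assumed measurable: it will be built from derive1 of functions that
   are arbitrary outside [a, b]. *)
Lemma ae_ge0_le_integralT (f g : R -> \bar R) :
  (forall x, 0 <= f x)%E -> (forall x, 0 <= g x)%E -> measurable_fun [set: R] g ->
  {ae mu, forall x, (f x <= g x)%E} ->
  (\int[mu]_x f x <= \int[mu]_x g x)%E.
Proof.
(* The integral of [f] is a supremum over simple functions below [f], and these are measurable. *)
move=> f0 g0 mg fg; rewrite ge0_integralTE//; apply: ge_ereal_sup => _ [h hf <-].
rewrite -integralT_nnsfun; apply: ae_ge0_le_integral => //.
- by move=> x _; rewrite lee_fin.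
- by apply/measurable_EFinP.
- by apply: ae_imply fg => x fgx _; exact: le_trans (hf x) fgx.
Qed.

(* The theorem for an abstract operator J alpha f, in terms of measurable
   functions, so that it can be transported along x |-> -x: F alpha is the
   absolutely continuous representative and d alpha its derivative. *)
Definition frac_limit (a b : R) (J : R -> R -> R) (f : R -> R) : Prop :=
  exists (rho : R -> R) (d F : R -> R -> R), 
  [/\ measurable_fun [set: R] rho,
      {ae mu, forall x, a < x < b -> is_derive x (1 : R) f (rho x)},
      forall alpha : R, 0 < alpha -> [/\ measurable_fun [set: R] (d alpha),
        {ae mu, forall x, a < x < b -> is_derive x (1 : R) (F alpha) (d alpha x)},
        abs_continuous a b (F alpha) &
        forall x, a <= x <= b -> J alpha x = F alpha x] &
      (\int[mu]_(x in `[a, b]) `|d alpha x - rho x|%:E)%E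
        @[alpha --> (0 : R)^'+] --> 0%E].

(** If [f x] and [g x] differed, continuity would keep [f] and [g] apart on an interval to the right
    of [x], which has positive measure. *)
Lemma abs_continuous_ae_eq (a b : R) (f g : R -> R) :
  abs_continuous a b f -> abs_continuous a b g ->
  ae_eq mu `[a, b]%classic f g -> forall x, a <= x < b -> f x = g x.
Proof.
move=> acf acg [N [mN N0 subN]] x /andP[ax xb].
have H := abs_continuous_dist (abs_continuousB acf acg).
apply/eqP; rewrite -subr_eq0 -normr_eq0; apply/negPn/negP => h0.
have e0 : 0 < `|f x - g x| by rewrite lt_neqAle eq_sym h0/=.
have [d d0 Hd] := H _ e0.
pose y := Num.min b (x + d); have xy : x < y by rewrite lt_min xb ltrDl.
have : (mu `]x, y[ <= mu N)%E.
  apply: le_measure; rewrite ?inE// => z /=; rewrite in_itv/= => /andP[xz].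
  rewrite lt_min => /andP[zb zxd]; apply: subN => /= E.
  have := Hd x z ax (ltW xz) (ltW zb); rewrite ltrBlDl => /(_ zxd).
  rewrite E ?subrr ?sub0r ?normrN ?ltxx//.
  by rewrite in_itv/= (ltW zb) (le_trans ax (ltW xz)).
by rewrite N0 lebesgue_measure_itv/= lte_fin xy -EFinB lee_fin subr_le0 leNgt xy.
Qed.

Lemma near_itvoo (a b x : R) : a < x -> x < b -> \forall y \near x, a < y < b.
Proof.
move=> ax xb; near=> y; apply/andP; split; near: y.
  exact: lt_nbhsr.
exact: lt_nbhsl.
Unshelve. all: by end_near. Qed.

Lemma is_derive_itvoo (a b : R) (f g : R -> R) (x l : R) : a < x < b ->
  (forall y, a < y < b -> f y = g y) -> is_derive x (1 : R) f l ->
  is_derive x (1 : R) g l.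
Proof.
move=> /andP[ax xb] fg; apply: near_eq_is_derive.
by move: (near_itvoo ax xb); apply: filterS => y; exact: fg.
Qed.

(** Any chosen representative agrees with [F alpha] on []a, b[], so its derivative is [d alpha] a.e.
    there; the norm is then squeezed between 0 and the integral in [frac_limit]. *)
Lemma frac_limit_cvg (a b : R) (J : R -> R -> R) (f : R -> R) : a < b ->
  frac_limit a b J f ->
  (forall alpha : R, 0 < alpha -> has_AC_rep a b (J alpha)) /\
  (L1norm a b (fun x : R => derive1 (AC_rep a b (J alpha)) x - derive1 f x)
    @[alpha --> (0 : R)^'+] --> 0%E).
Proof.
move=> ab [rho [d [F [mrho frho dF lim]]]].
have rep (alpha : R) : 0 < alpha -> is_AC_rep a b (J alpha) (F alpha).
  move=> a0; have [_ _ acF JF] := dF _ a0; split => //.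
  by apply: aeW => x /=; rewrite in_itv/= => xab; exact: JF.
split; first by move=> alpha a0; exists (F alpha); exact: rep.
pose norm (alpha : R) :=
  L1norm a b (fun x : R => derive1 (AC_rep a b (J alpha)) x - derive1 f x).
have le (alpha : R) : 0 < alpha -> (0 <= norm alpha <=
     \int[mu]_(x in `[a, b]) `|d alpha x - rho x|%:E)%E.
  move=> a0; rewrite /norm /L1norm Lnorm_ge0/= Lnorm1.
  have [md dFd acF JF] := dF _ a0.
  set G := AC_rep a b (J alpha).
  have [acG JG] : is_AC_rep a b (J alpha) G.
    rewrite /G /AC_rep; apply: (xgetPex _ (P := is_AC_rep a b (J alpha))).
    by exists (F alpha); exact: rep.
  have GF x : a < x < b -> F alpha x = G x.
    move=> /andP[ax xb]; apply: (abs_continuous_ae_eq acF acG); last by rewrite ltW.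
    apply: ae_imply JG => y Jy yab; rewrite -Jy// JF//.
  rewrite [leRHS]integral_mkcond; apply: ae_ge0_le_integralT.
  - by move=> x.
  - by move=> x; apply: erestrict_ge0 => y _; rewrite lee_fin.
  - apply/(measurable_restrictT _ _).1 => //; apply/measurable_EFinP.
    by apply: measurable_funTS; apply: measurableT_comp => //; exact: measurable_funB.
  (* At [a] and [b] the two-sided derivatives depend on values outside [[a, b]], so both points are
     removed. *)
  have ends : {ae mu, forall x, x != a /\ x != b}.
    exists [set a; b]; split.
    - by apply: measurableU.
    - apply: countable_lebesgue_measure0.
      apply/finite_set_countable/finite_set2.
    - move=> x /= /not_andP[/negP|/negP]; rewrite negbK => /eqP ->; [by left|by right].
  have fil := ae_filter_ringOfSetsType mu.
  have good : {ae mu, forall x, (x != a /\ x != b) /\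
      ((a < x < b -> is_derive x (1 : R) f (rho x)) /\
       (a < x < b -> is_derive x (1 : R) (F alpha) (d alpha x)))}.
    exact: filterI ends (filterI frho dFd).
  apply: ae_imply good => x [[xa xb] [fx Fx]].
  rewrite /= !patchE; case: ifPn => [|_]; last by rewrite normr0.
  rewrite mem_setE in_itv/= => /andP[ax bx].
  have xab : a < x < b by rewrite !lt_neqAle ax bx eq_sym xa xb.
  have [_ Ef] := fx xab.
  have [_ EG] := is_derive_itvoo xab GF (Fx xab).
  by rewrite !derive1E Ef EG.
apply/cvge_at_rightP => u [u0 ucvg].
have ulim : (\int[mu]_(x in `[a, b]) `|d (u n) x - rho x|%:E)%E @[n --> \oo] --> 0%E.
  by move/cvge_at_rightP: lim; apply.
apply: (squeeze_cvge _ (cvg_cst _) ulim).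
by apply: nearW => n; exact: le.
Qed.


Definition density_after (a : R) (r : R -> R) : Prop :=
  [/\ measurable_fun [set: R] r, forall x, 0 <= r x,
      (\int[mu]_x (r x)%:E < +oo)%E & forall x, x <= a -> r x = 0].

(** Jordan decomposition [f = V - W] with [V] the total variation from [a]; both parts are
    nondecreasing and absolutely continuous. As [f a = 0], both vanish at [a] and no additive
    constant appears. *)
Lemma abs_continuous_primitives (a b : R) (f : R -> R) : a < b ->
  abs_continuous a b f -> f a = 0 ->
  exists r1 r2, [/\ density_after a r1, density_after a r2 &
    forall x, a <= x <= b -> f x = primitive r1 x - primitive r2 x].
Proof.
move=> ab acf fa; have bv := abs_continuous_BV ab acf.
pose V x := fine (total_variation a x f); pose W x := V x - f x.
have acV : abs_continuous a b V by exact: abs_continuous_total_variation.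
have acW : abs_continuous a b W by exact: abs_continuousB.
have Vge x y : a <= x -> x <= y -> y <= b -> `|f y - f x| <= V y - V x.
  move=> ax xy yb; rewrite (fine_total_variationB bv ax xy yb) -lee_fin fineK.
    exact: total_variation_ge.
  have bvy := bounded_variationl (le_trans ax xy) yb bv.
  by apply/(bounded_variationP _ xy); exact: (bounded_variationr ax xy bvy).
have ndV : {in `[a, b] &, nondecreasing_fun V}.
  move=> x y; rewrite !in_itv/= => /andP[ax _] /andP[_ yb] xy.
  by rewrite -subr_ge0; apply: le_trans (Vge _ _ ax xy yb).
have ndW : {in `[a, b] &, nondecreasing_fun W}.
  move=> x y; rewrite !in_itv/= => /andP[ax _] /andP[_ yb] xy.
  by have := le_trans (ler_norm _) (Vge _ _ ax xy yb); rewrite /W; lra.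
have Va : V a = 0 by rewrite /V total_variationxx.
have primE g r : (\int[mu]_x (r x)%:E < +oo)%E -> measurable_fun [set: R] r ->
    (forall x, 0 <= r x) -> g a = 0 ->
    (forall x, a <= x -> x <= b ->
      (\int[mu]_(t in `]-oo, x]) (r t)%:E = (g x - g a)%:E)%E) ->
    forall x, a <= x -> x <= b -> primitive r x = g x.
  move=> ir mr r0 ga E x ax xb; apply/EFin_inj.
  by rewrite primitiveE// E// ga subr0.
have [r1 [mr1 r10 ir1 r1a E1]] := abs_continuous_density ab acV ndV.
have [r2 [mr2 r20 ir2 r2a E2]] := abs_continuous_density ab acW ndW.
have notin x : x <= a -> ~ `]a, b]%classic x.
  by move=> xa /=; rewrite in_itv/= ltNge xa.
exists r1, r2; split.
- by split => // x xa; exact/r1a/notin.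
- by split => // x xa; exact/r2a/notin.
- move=> x /andP[ax xb]; rewrite (primE V)// (primE W)//; last first.
    by rewrite /W Va fa subrr.
  by rewrite /W; ring.
Qed.

Lemma abs_continuous_integrable_left_J (a b alpha : R) (f : R -> R) (x : R) :
  a < b -> abs_continuous a b f -> f a = 0 -> 0 < alpha -> a <= x <= b ->
  mu.-integrable `[a, x] (fun t => (expint1 ((x - t) / alpha) * f t)%:E).
Proof.
move=> ab acf fa a0 /andP[ax xb].
have [r1 [r2 [[mr1 r10 ir1 r1a] [mr2 r20 ir2 r2a] fE]]] :=
  abs_continuous_primitives ab acf fa.
have [i1 _] := integrable_left_J mr1 r10 ir1 a0 r1a ax.
have [i2 _] := integrable_left_J mr2 r20 ir2 a0 r2a ax.
apply: eq_integrable (integrableB _ i1 i2) => // t /[!inE]/=.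
rewrite in_itv/= => /andP[at_ tx].
by rewrite -EFinB -mulrBr fE// at_ (le_trans tx).
Qed.

(** All the data are differences of those attached to the two Jordan densities; the triangle
    inequality reduces the limit to [cvg_frac_conv] for each. *)
Lemma left_frac_limit (a b : R) (f : R -> R) : a < b ->
  abs_continuous a b f -> f a = 0 ->
  frac_limit a b (fun alpha => left_J a alpha f) f.
Proof.
move=> ab acf fa.
have [r1 [r2 [[mr1 r10 ir1 r1a] [mr2 r20 ir2 r2a] fE]]] :=
  abs_continuous_primitives ab acf fa.
exists (fun x => r1 x - r2 x),
  (fun alpha x => frac_density r1 alpha x - frac_density r2 alpha x),
  (fun alpha x =>
     primitive (frac_density r1 alpha) x - primitive (frac_density r2 alpha) x).
have prim_deriv (s1 s2 : R -> R) :
    measurable_fun [set: R] s1 -> measurable_fun [set: R] s2 ->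
    (forall x, 0 <= s1 x) -> (forall x, 0 <= s2 x) ->
    (\int[mu]_x (s1 x)%:E < +oo)%E -> (\int[mu]_x (s2 x)%:E < +oo)%E ->
    {ae mu, forall x,
      is_derive x (1 : R) (fun x => primitive s1 x - primitive s2 x) (s1 x - s2 x)}.
  move=> ms1 ms2 s10 s20 is1 is2.
  have good : {ae mu, forall x, is_derive x (1 : R) (primitive s1) (s1 x) /\
       is_derive x (1 : R) (primitive s2) (s2 x)}.
    have fil := ae_filter_ringOfSetsType mu.
    exact: filterI (primitive_derivable ms1 s10 is1) (primitive_derivable ms2 s20 is2).
  by apply: ae_imply good => x [d1 d2]; exact: is_deriveB.
split.
- exact: measurable_funB.
- apply: ae_imply (prim_deriv _ _ mr1 mr2 r10 r20 ir1 ir2) => x dx xab.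
  apply: (is_derive_itvoo xab _ dx) => y /andP[ay yb].
  by rewrite fE// !ltW.
- move=> alpha a0; split.
  + by apply: measurable_funB; exact: measurable_frac_density.
  + apply: ae_imply (prim_deriv (frac_density r1 alpha) (frac_density r2 alpha)
      _ _ _ _ _ _) => //.
    * exact: measurable_frac_density.
    * exact: measurable_frac_density.
    * exact: frac_density_ge0.
    * exact: frac_density_ge0.
    * exact: integral_frac_densityT_lty.
    * exact: integral_frac_densityT_lty.
  + apply: abs_continuousB; apply: abs_continuous_primitive => //.
    * exact: measurable_frac_density.
    * exact: frac_density_ge0.
    * exact: integral_frac_densityT_lty.
    * exact: measurable_frac_density.
    * exact: frac_density_ge0.
    * exact: integral_frac_densityT_lty.
  + move=> x /andP[ax xb].
    have [i1 <-] := integrable_left_J mr1 r10 ir1 a0 r1a ax.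
    have [i2 <-] := integrable_left_J mr2 r20 ir2 a0 r2a ax.
    rewrite /left_J -mulrBr -RintegralB//; congr (_ * _).
    apply: eq_Rintegral => t /[!inE]/=; rewrite in_itv/= => /andP[at_ tx].
    by rewrite -mulrBr fE// at_ (le_trans tx).
- apply/cvge_at_rightP => u [u0 ucvg].
  have c1 := cvg_frac_conv mr1 r10 ir1 u0 ucvg.
  have c2 := cvg_frac_conv mr2 r20 ir2 u0 ucvg.
  have c12 : (\int[mu]_x `|frac_conv (u n) r1 x - (r1 x)%:E| +
      \int[mu]_x `|frac_conv (u n) r2 x - (r2 x)%:E|)%E @[n --> \oo] --> 0%E.
    by rewrite -[X in _ --> X]adde0; exact: cvgeD.
  apply: (squeeze_cvge _ (cvg_cst _) c12); apply: nearW => n; rewrite integral_ge0//=.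
  pose A (r : R -> R) x := `|frac_conv (u n) r x - (r x)%:E|%E.
  have mA (r : R -> R) : measurable_fun [set: R] r -> (forall x, 0 <= r x) ->
      measurable_fun [set: R] (A r).
    move=> mr r0; apply: measurableT_comp => //; apply: emeasurable_funB.
      exact: measurable_frac_conv.
    exact/measurable_EFinP.
  rewrite -ge0_integralD//; last 2 first.
  - exact: mA.
  - exact: mA.
  rewrite [leLHS]integral_mkcond; apply: ae_ge0_le_integralT => //.
  - by move=> x; apply: erestrict_ge0.
  - by move=> x; rewrite adde_ge0.
  - by apply: emeasurable_funD; exact: mA.
  have good : {ae mu, forall x, (frac_density r1 (u n) x)%:E = frac_conv (u n) r1 x /\
      (frac_density r2 (u n) x)%:E = frac_conv (u n) r2 x}.
    have fil := ae_filter_ringOfSetsType mu.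
    exact: filterI (frac_densityE mr1 r10 ir1 (u0 n))
      (frac_densityE mr2 r20 ir2 (u0 n)).
  apply: ae_imply good => x [<- <-]; rewrite patchE; case: ifPn => [_|_].
    rewrite -!EFinB !abse_EFin -EFinD lee_fin.
    rewrite (_ : _ - _ =
        (frac_density r1 (u n) x - r1 x) - (frac_density r2 (u n) x - r2 x)).
      exact: ler_normB.
    by ring.
  by rewrite adde_ge0.
Qed.

End frac_limit.

(** * Reflection and the right-sided case *)

Section frac_limit_reflection.
Context {R : realType}.
Notation mu := (@lebesgue_measure R).

Lemma integral_reflect (c : R) (D : set R) (g : R -> \bar R) : measurable D ->
  measurable_fun D g ->
  (\int[mu]_(x in (fun x => c - x)%R @^-1` D) g (c - x)%R = \int[mu]_(x in D) g x)%E.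
Proof.
move=> mD mg; rewrite integralE [RHS]integralE; congr (_ - _)%E.
  rewrite -(ge0_integral_reflect c mD (measurable_funepos mg) (fun x _ => funepos_ge0 g x)).
  by apply: eq_integral => x _; rewrite !funeposE.
rewrite -(ge0_integral_reflect c mD (measurable_funeneg mg) (fun x _ => funeneg_ge0 g x)).
by apply: eq_integral => x _; rewrite !funenegE.
Qed.

Lemma ae_opp (P : R -> Prop) : {ae mu, forall x, P x} -> {ae mu, forall x, P (- x)}.
Proof.
move=> [N [mN N0 PN]]; exists ((fun x => 0 - x) @^-1` N); split.
- by rewrite -[X in measurable X]setTI; exact: measurable_subrl.
- by rewrite lebesgue_measure_reflect.
- by move=> x /= Px; apply: PN; rewrite /= sub0r.
Qed.

Lemma abs_continuous_opp (a b : R) (f : R -> R) : abs_continuous a b f ->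
  abs_continuous (- b) (- a) (fun x => f (- x)).
Proof.
move=> ac e e0; have [d d0 H] := ac e e0; exists d => // n u v uv tr uvd.
have := H n (fun i => - v i) (fun i => - u i).
have sE : \sum_(i < n) (- u i - - v i) = \sum_(i < n) (v i - u i).
  by apply: eq_bigr => i _; rewrite opprK addrC.
rewrite sE => {}H.
have {}H : \sum_(i < n) `|f (- u i) - f (- v i)| < e.
  apply: H => // [i|i j _ _ [z [/=]]].
    by have [h1 [h2 h3]] := uv i; split; [|split]; lra.
  rewrite !in_itv/= => /andP[h1 h2] /andP[h3 h4].
  apply: (tr _ _ I I); exists (- z).
  by split; rewrite /= in_itv/=; apply/andP; split; lra.
by under eq_bigr do rewrite distrC.
Qed.

Lemma is_derive_opp (f : R -> R) (x l : R) :
  is_derive (- x) (1 : R) (fun y => f (- y)) l -> is_derive x (1 : R) f (- l).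
Proof.
move=> df; have -> : f = (fun y => f (- y)) \o -%R.
  by apply/funext => y /=; rewrite opprK.
by rewrite -mulrN1; apply: is_derive1_comp.
Qed.

(** By the chain rule the derivatives [rho] and [d] change sign under reflection while [F] does not;
    the absolute value in the integral absorbs the sign. *)
Lemma frac_limit_opp (a b : R) (J J' : R -> R -> R) (f : R -> R) :
  frac_limit (- b) (- a) J' (fun x => f (- x)) ->
  (forall alpha x, 0 < alpha -> a <= x <= b -> J alpha x = J' alpha (- x)) ->
  frac_limit a b J f.
Proof.
move=> [rho [d [F [mrho frho dF lim]]]] JJ'.
have oppitv x : a < x < b -> - b < - x < - a.
  by move=> /andP[? ?]; rewrite !ltrN2; apply/andP.
have mN : measurable_fun [set: R] (-%R : R -> R) by exact: oppr_measurable.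
exists (fun x => - rho (- x)), (fun alpha x => - d alpha (- x)),
  (fun alpha x => F alpha (- x)).
split.
- by apply: measurableT_comp => //; apply: measurableT_comp.
- apply: ae_imply (ae_opp frho) => x fx /oppitv /fx; exact: is_derive_opp.
- move=> alpha a0; have [md dFd acF JF] := dF _ a0; split.
  + by apply: measurableT_comp => //; apply: measurableT_comp.
  + apply: ae_imply (ae_opp dFd) => x Fx /oppitv /Fx dx.
    apply: (is_derive_opp (f := fun x => F alpha (- x))).
    by under eq_fun do rewrite opprK.
  + by have := abs_continuous_opp acF; rewrite !opprK.
  + by move=> x /andP[ax xb]; rewrite JJ' ?ax//; apply: JF; rewrite !lerN2 ax xb.
- apply: cvg_trans lim; apply: near_eq_cvg.
  near=> alpha; have a0 : 0 < alpha by near: alpha; exact: nbhs_right_gt.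
  have [md _ _ _] := dF _ a0.
  rewrite -[LHS](@ge0_integral_reflect _ 0)//.
    rewrite (_ : _ @^-1` _ = `[a, b]%classic).
      apply: eq_integral => x _; rewrite sub0r; congr _%:E.
      by rewrite -opprD normrN.
    by apply/seteqP; split => x /=; rewrite !in_itv/= sub0r !lerN2 andbC.
  apply/measurable_EFinP/measurable_funTS; apply: measurableT_comp => //.
  exact: measurable_funB.
Unshelve. all: by end_near. Qed.

(** Substitution t |-> -t; the measurability it requires comes from the integrability of the
    left-sided integrand of the reflected function. *)
Lemma right_JE (a b alpha : R) (f : R -> R) (x : R) : a < b ->
  abs_continuous a b f -> f b = 0 -> 0 < alpha -> a <= x <= b ->
  right_J b alpha f x = left_J (- b) alpha (fun y => f (- y)) (- x).
Proof.
move=> ab acf fb a0 xab; rewrite /right_J /left_J; congr (_ * fine _).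
have ab' : - b < - a by rewrite ltrN2.
have fb' : f (- - b) = 0 by rewrite opprK.
have xab' : - b <= - x <= - a by rewrite !lerN2 andbC.
have := abs_continuous_integrable_left_J ab' (abs_continuous_opp acf) fb' a0 xab'.
move=> /measurable_int mg.
rewrite -(integral_reflect 0 _ mg)// (_ : _ @^-1` _ = `[x, b]%classic).
  by apply: eq_integral => t _; rewrite sub0r !opprK (addrC (- x)).
by apply/seteqP; split => t /=; rewrite !in_itv/= sub0r !lerN2 andbC.
Qed.

Lemma right_frac_limit (a b : R) (f : R -> R) : a < b ->
  abs_continuous a b f -> f b = 0 ->
  frac_limit a b (fun alpha => right_J b alpha f) f.
Proof.
move=> ab acf fb.
apply: (@frac_limit_opp _ _ _ (fun alpha => left_J (- b) alpha (fun y => f (- y)))).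
  apply: left_frac_limit; rewrite ?ltrN2 ?opprK//.
  exact: abs_continuous_opp.
by move=> alpha x a0 xab; exact: right_JE xab.
Qed.

End frac_limit_reflection.

Theorem theorem4p11 (R : realType) (a b : R) (hab : a < b) :
  (forall f : R -> R, abs_continuous a b f -> f a = 0 ->
     (forall alpha : R, 0 < alpha -> has_AC_rep a b (left_J a alpha f)) /\
     (L1norm a b (fun x : R => left_frac_derive a b alpha f x - derive1 f x)
        @[alpha --> (0 : R)^'+] --> 0%E)) /\
  (forall f : R -> R, abs_continuous a b f -> f b = 0 ->
     (forall alpha : R, 0 < alpha -> has_AC_rep a b (right_J b alpha f)) /\
     (L1norm a b (fun x : R => right_frac_derive a b alpha f x - derive1 f x)
        @[alpha --> (0 : R)^'+] --> 0%E)).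
Proof.
split=> f acf f0.
  exact: frac_limit_cvg hab (left_frac_limit hab acf f0).
exact: frac_limit_cvg hab (right_frac_limit hab acf f0).
Qed.
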